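(* Let $m\geq 2$ and $r\geq 3$ be integers. There exists a constant $a_{m,r}>0$, depending only on $m$ and $r$, such that for every integer $t\geq 2$, $$R(C^r_{2m},K^r_t)\leq a_{m,r}\left(\frac{t}{\ln t}\right)^{\frac{m}{m-1}}.$$
   Context: An $r$-graph is an $r$-uniform hypergraph. $K^r_t$ is the complete $r$-graph on $t$ vertices. $C^r_{k}$ is the $r$-uniform linear cycle of length $k$: edges $e_1,\ldots,e_k$ with $|e_i\cap e_{i+1}|=1$ for $i\in[k-1]$, $|e_k\cap e_1|=1$, and $e_i\cap e_j=\emptyset$ for all other pairs $i\neq j$. For $r$-graphs $G,H$, the Ramsey number $R(G,H)$ is the smallest positive integer $n$ such that every red/blue coloring of the edges of $K^r_n$ contains a red copy of $G$ or a blue copy of $H$. *)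

(* Defs.v *)
From mathcomp Require Import all_boot.

Set Implicit Arguments.
Unset Strict Implicit.
Unset Printing Implicit Defensive.

Record uhypergraph (r : nat) := UHypergraph {
  vertex : finType;
  edges : {set {set vertex}};
  edges_uniform : forall e, e \in edges -> #|e| = r
}.

Definition complete_edges (r t : nat) : {set {set 'I_t}} :=
  [set e : {set 'I_t} | #|e| == r].

Lemma complete_edges_uniform r t e : e \in complete_edges r t -> #|e| = r.
Proof. by rewrite inE => /eqP. Qed.

Definition complete_uhypergraph (r t : nat) : uhypergraph r :=
  UHypergraph (@complete_edges_uniform r t).

(* Edges are indexed cyclically by 'I_k, and ordS is the cyclic successor.
   The covering clause says that C has no isolated vertices. The clauses
   determine C up to isomorphism when 4 <= k; for k = 3 they do not exclude a
   vertex common to all three edges. *)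
Definition is_linear_cycle (r k : nat) (C : uhypergraph r) : Prop :=
  exists e : 'I_k -> {set vertex C},
    [/\ edges C = [set e i | i : 'I_k],
        forall v : vertex C, exists i, v \in e i,
        forall i, #|e i :&: e (ordS i)| = 1
      & forall i j, i != j -> j != ordS i -> i != ordS j ->
          e i :&: e j = set0].

Definition contains_copy (r : nat) (V : finType) (E : {set {set V}})
    (G : uhypergraph r) : Prop :=
  exists2 f : vertex G -> V,
    injective f & forall e, e \in edges G -> f @: e \in E.

(* A colouring c is only ever evaluated on the edges of the complete r-graph
   on 'I_n; true stands for red and false for blue. *)
Definition ramsey_arrow (r : nat) (G H : uhypergraph r) (n : nat) : Prop :=
  forall c : {set 'I_n} -> bool,
    contains_copy [set e in complete_edges r n | c e] G \/
    contains_copy [set e in complete_edges r n | ~~ c e] H.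

Definition is_ramsey_number (r : nat) (G H : uhypergraph r) (n : nat) : Prop :=
  [/\ 0 < n, ramsey_arrow G H n
    & forall n', 0 < n' -> ramsey_arrow G H n' -> n <= n'].

(* Linear cycles exist: block i of the vertex set 'I_k * 'I_(r - 1), together
   with the first vertex of the next block, is the i-th edge. *)
Lemma linear_cycle_exists (r k : nat) : 2 <= r -> 4 <= k ->
  exists C : uhypergraph r, is_linear_cycle k C.
Proof.
case: r => [//|[//|q]] _ k4.
pose e (i : 'I_k) : {set 'I_k * 'I_q.+1} :=
  (ordS i, ord0) |: [set (i, x) | x : 'I_q.+1].
have inE' i v : (v \in e i) = (v == (ordS i, ord0)) || (v.1 == i).
  rewrite !inE; congr orb; apply/imsetP/eqP => [[x _ ->]//|].
  by case: v => a b /= ->; exists b.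
have S1 (i : 'I_k) : ordS i != i.
  apply/eqP => /(congr1 val) /=.
  have := ltn_ord i; rewrite leq_eqVlt => /orP[/eqP h|h].
    by rewrite h modnn => h0; move: k4; rewrite -h -h0.
  by rewrite modn_small // => /eqP; rewrite eqn_leq ltnn.
have S2 (i : 'I_k) : ordS (ordS i) != i.
  apply/eqP => /(congr1 val) /=.
  have := ltn_ord i; rewrite leq_eqVlt => /orP[/eqP h|h].
    rewrite h modnn modn_small; last exact: leq_trans k4.
    by move=> h0; move: k4; rewrite -h -h0.
  rewrite (modn_small h); move: h; rewrite leq_eqVlt => /orP[/eqP h|h].
    by rewrite h modnn => h0; move: k4; rewrite -h -h0.
  by rewrite modn_small // => h0; move: (leqnSn i.+1); rewrite h0 ltnn.
have eU : forall X, X \in [set e i | i : 'I_k] -> #|X| = q.+2.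
  move=> X /imsetP[i _ ->]; rewrite cardsU1 card_imset ?card_ord.
    rewrite (_ : _ \notin _) //; apply/imsetP => -[x _ [h _]].
    by move: (S1 i); rewrite -[X in _ != X]h eqxx.
  by move=> x y [].
exists (UHypergraph eU); exists e; split => //.
- by move=> v; exists v.1; rewrite inE' eqxx orbT.
- move=> i; apply/eqP/cards1P; exists (ordS i, ord0).
  apply/setP => -[a b]; rewrite in_setI !inE' in_set1 /= !xpair_eqE.
  case: (eqVneq a (ordS i)) => [->|nai] /=.
    by rewrite (negbTE (S1 i)) orbF orbT andbT.
  rewrite orbF; case: (eqVneq a i) => //= ->.
  by rewrite eq_sym (negbTE (S2 i)).
- move=> i j ij ji jj; apply/setP => -[a b].
  rewrite in_setI !inE' in_set0 /= !xpair_eqE.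
  case: (eqVneq a i) => [->|nai] /=.
    by rewrite (negbTE ij) (negbTE jj) orbT.
  rewrite orbF; case: (eqVneq a (ordS i)) => //= ->.
  rewrite (eq_sym _ j) (negbTE ji) orbF (inj_eq (@ordS_inj k)) (negbTE ij).
  by rewrite andbF.
Qed.

(* Main.v *)
(** Call a vertex set robust if it extends to a red edge avoiding any prescribed
    bounded set of other vertices, and let the kernels be the minimal robust sets
    with at least two elements. Every red edge contains a kernel, every pair of
    vertices lies in boundedly many kernels, and a linear cycle of kernels extends
    to a red linear cycle.

    Closed walks of length 2m in the shadow graph of the kernels are therefore all
    degenerate. Janzer's homomorphism counting bounds the degenerate ones and gives
    d^2 = O(Delta n^(1/m)) for every induced subgraph with average degree d and
    maximum degree Delta. Deleting vertices of high degree repeatedly, with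
    summable losses, leaves at least 3n/4 vertices spanning a shadow graph of
    average degree O(n^(1/m)).

    The graph of 2-element kernels has O(n^(1+1/m)) triangles, because a
    neighbourhood contains no path on 2m - 1 vertices. A random subset of density
    about n^(-1/(2m)) then contains few triangles and few kernels of size at least
    3; destroying them leaves a triangle-free graph of degree O(n^(1/(2m))) to
    which the Ajtai-Komlos-Szemeredi bound applies, producing a blue clique of
    order n^(1-1/m) log n. *)
Require Import Defs.
From mathcomp Require Import all_boot zify ring.

Set Implicit Arguments.
Unset Strict Implicit.
Unset Printing Implicit Defensive.

(** * Cauchy-Schwarz and log-convexity for natural numbers *)

(** After doubling, both sides are sums over pairs (i, j), compared termwise by 2xy <= x^2 + y^2
    with x = [a i * b j] and y = [a j * b i]. *)
Lemma sum_nat_CauchySchwarz (I : finType) (a b : I -> nat) :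
  (\sum_i a i * b i) ^ 2 <= (\sum_i a i ^ 2) * (\sum_i b i ^ 2).
Proof.
rewrite -(leq_pmul2l (isT : 0 < 2)) expnS expn1.
have -> : 2 * ((\sum_i a i * b i) * (\sum_i a i * b i)) =
    \sum_i \sum_j 2 * ((a i * b j) * (a j * b i)).
  rewrite big_distrlr /= big_distrr /=; apply: eq_bigr => i _.
  by rewrite big_distrr /=; apply: eq_bigr => j _; nia.
have -> : 2 * ((\sum_i a i ^ 2) * (\sum_i b i ^ 2)) =
    \sum_i \sum_j ((a i * b j) ^ 2 + (a j * b i) ^ 2).
  rewrite mul2n -addnn {2}mulnC !big_distrlr /= -big_split /=.
  apply: eq_bigr => i _; rewrite -big_split /=; apply: eq_bigr => j _.
  by rewrite !expnMn; nia.
by apply: leq_sum => i _; apply: leq_sum => j _; apply: nat_Cauchy.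
Qed.

Lemma sum_nat_sqr_le (I : finType) (a : I -> nat) :
  (\sum_i a i) ^ 2 <= #|I| * \sum_i a i ^ 2.
Proof.
have := sum_nat_CauchySchwarz (fun _ : I => 1) a.
by under eq_bigr do rewrite mul1n; rewrite sum_nat_const muln1.
Qed.

Section LogConvex.
Variable u : nat -> nat.
Hypothesis u_logconvex : forall j, u j.+1 ^ 2 <= u j * u j.+2.

(** Log-convexity makes the ratios of consecutive terms nondecreasing; the inequalities of this
    section are cross-multiplied so that zero terms are allowed. *)
Lemma logconvex_first_ratio j : u 1 * u j <= u 0 * u j.+1.
Proof.
elim: j => [|j IH]; first by rewrite mulnC.
have := u_logconvex j.
case: (posnP (u j.+1)) => [->|uj H]; first by rewrite muln0.
rewrite -(leq_pmul2r uj) -mulnA mulnn.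
apply: leq_trans (leq_mul (leqnn _) H) _.
by rewrite mulnA -[leqRHS]mulnA [_ * u j.+1]mulnC mulnA leq_mul.
Qed.

Lemma logconvex_exp_le j : u 1 ^ j * u 0 <= u 0 ^ j * u j.
Proof.
elim: j => [|j IH]; first by rewrite !mul1n.
rewrite !expnS -mulnA; apply: leq_trans (leq_mul (leqnn _) IH) _.
rewrite mulnCA [leqRHS](_ : _ = u 0 ^ j * (u 0 * u j.+1)); last by nia.
by rewrite leq_mul // logconvex_first_ratio.
Qed.

(** A bound on the last ratio bounds all earlier ones, and the product of the ratios telescopes. *)
Lemma logconvex_last_ratio D j : u j.+1 <= D * u j -> u j.+1 <= D ^ j.+1 * u 0.
Proof.
elim: j => [|j IH] Hj; first by rewrite expn1.
have Hj1 : u j.+1 <= D * u j.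
  case: (posnP (u j.+1)) => [->//|uj].
  rewrite -(leq_pmul2r uj) mulnn; apply: leq_trans (u_logconvex j) _.
  by rewrite [D * _]mulnC -mulnA leq_mul.
apply: leq_trans Hj _; rewrite expnS -mulnA leq_mul //; exact: IH.
Qed.
End LogConvex.

(** * Counting walks *)

(* [wsum F j x y f] is the sum of [f p] over all walks [x :: p] of length [j]
   from [x] to [y]. *)
Fixpoint wsum (V : finType) (F : rel V) j (x y : V) (f : seq V -> nat) : nat :=
  if j is j'.+1 then \sum_(z | F x z) wsum F j' z y (fun p => f (z :: p))
  else (x == y) * f [::].

Definition nwalks (V : finType) (F : rel V) j x y := wsum F j x y (fun=> 1).

Section Walks.
Variables (V : finType) (F : rel V).
Hypothesis Fsym : symmetric F.
Local Notation wsum := (wsum F).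
Local Notation w := (nwalks F).

Lemma leq_wsum j x y f g :
  (forall p, size p = j -> path F x p -> last x p = y -> f p <= g p) ->
  wsum j x y f <= wsum j x y g.
Proof.
elim: j x f g => [|j IH] x f g H /=.
  by case: eqVneq => // xy; rewrite !mul1n H.
apply: leq_sum => z xz; apply: IH => p sp pp lp.
by apply: H => //=; rewrite ?sp ?xz.
Qed.

Lemma eq_wsum j x y f g :
  (forall p, size p = j -> path F x p -> last x p = y -> f p = g p) ->
  wsum j x y f = wsum j x y g.
Proof.
by move=> H; apply/eqP; rewrite eqn_leq !leq_wsum // => p *; rewrite H.
Qed.

Lemma wsum_sum (I : finType) (P : pred I) j x y (f : I -> seq V -> nat) :
  wsum j x y (fun p => \sum_(i | P i) f i p) = \sum_(i | P i) wsum j x y (f i).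
Proof.
elim: j x f => [|j IH] x f /=; first by rewrite big_distrr.
by rewrite exchange_big; apply: eq_bigr => z _; rewrite IH.
Qed.

Lemma wsumMl j x y a (f : seq V -> nat) :
  wsum j x y (fun p => a * f p) = a * wsum j x y f.
Proof.
elim: j x f => [|j IH] x f /=; first by rewrite mulnCA.
by rewrite big_distrr; apply: eq_bigr => z _; rewrite IH.
Qed.

Lemma wsumMr j x y a (f : seq V -> nat) :
  wsum j x y (fun p => f p * a) = wsum j x y f * a.
Proof.
rewrite mulnC -wsumMl; apply: eq_wsum => p _ _ _; exact: mulnC.
Qed.

Lemma wsum_cat i j x y f :
  wsum (i + j) x y f =
  \sum_z wsum i x z (fun p => wsum j z y (fun q => f (p ++ q))).
Proof.
elim: i x f => [|i IH] x f /=.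
  rewrite (bigD1 x) //= eqxx mul1n big1 ?addn0 // => z zx.
  by rewrite eq_sym (negbTE zx).
by rewrite exchange_big /=; apply: eq_bigr => z _; rewrite IH.
Qed.

Lemma wsum_exchange i j a b c d (f : seq V -> seq V -> nat) :
  wsum i a b (fun p => wsum j c d (f p)) =
  wsum j c d (fun q => wsum i a b (f^~ q)).
Proof.
elim: i a f => [|i IH] a f /=; first by rewrite wsumMl.
by rewrite wsum_sum; apply: eq_bigr => z _; rewrite IH.
Qed.

(** Cutting a closed walk after [i] steps and swapping the two pieces moves its base point to the
    cut; this is a bijection once all base points are summed over. *)
Lemma wsum_rot i k f : i <= k ->
  \sum_x wsum k x x (fun p => f (rot i p)) = \sum_x wsum k x x f.
Proof.
move=> ik; rewrite -{1}(subnKC ik) -{2}(subnK ik).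
under eq_bigr do rewrite wsum_cat; rewrite exchange_big /=.
apply: eq_bigr => z _; rewrite wsum_cat; apply: eq_bigr => x _.
rewrite wsum_exchange; apply: eq_wsum => p _ _ _.
by apply: eq_wsum => q <- _ _; rewrite rot_size_cat.
Qed.

Lemma nwalksD i j x y : w (i + j) x y = \sum_z w i x z * w j z y.
Proof.
by rewrite /nwalks wsum_cat; apply: eq_bigr => z _; rewrite -wsumMr;
  apply: eq_wsum => p *; rewrite mul1n.
Qed.

Lemma nwalks0 x y : w 0 x y = (x == y).
Proof. by rewrite /nwalks /= muln1. Qed.

Lemma nwalks1 x y : w 1 x y = F x y.
Proof.
rewrite /nwalks /= big_mkcond (bigD1 y) //= eqxx big1 ?addn0.
  by case: (F x y).
by move=> z zy; rewrite (negbTE zy) mul0n; case: ifP.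
Qed.

Lemma nwalks_sym j x y : w j x y = w j y x.
Proof.
elim: j x y => [|j IH] x y; first by rewrite !nwalks0 eq_sym.
have -> : w j.+1 y x = \sum_z w j y z * w 1 z x by rewrite -addn1 nwalksD.
rewrite (nwalksD 1 j); apply: eq_bigr => z _.
by rewrite !nwalks1 Fsym IH mulnC.
Qed.

(** For symmetric [F] this is the trace of the 2j-th power of the adjacency matrix, the number of
    closed walks of length 2j. *)
Definition walk_energy j := \sum_(p : V * V) w j p.1 p.2 ^ 2.

Lemma walk_energyE j : walk_energy j = \sum_x \sum_y w j x y ^ 2.
Proof. by rewrite pair_bigA. Qed.

(** Closed walks of length 2k may be cut at any position. The uneven cut into j and j+2 steps gives
    log-convexity by Cauchy-Schwarz. *)
Lemma walk_energy_closed i j k : i + j = k + k ->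
  walk_energy k = \sum_(p : V * V) w i p.1 p.2 * w j p.1 p.2.
Proof.
have E a b : \sum_(p : V * V) w a p.1 p.2 * w b p.1 p.2 = \sum_x w (a + b) x x.
  rewrite -(pair_bigA _ (fun x y => w a x y * w b x y)) /=.
  apply: eq_bigr => x _; rewrite nwalksD; apply: eq_bigr => y _.
  by rewrite (nwalks_sym b).
by move=> ij; rewrite E ij -E; apply: eq_bigr => p _; rewrite mulnn.
Qed.

Lemma walk_energy0 : walk_energy 0 = #|V|.
Proof.
rewrite walk_energyE -sum1_card; apply: eq_bigr => x _.
rewrite (bigD1 x) //= nwalks0 eqxx big1 // => y yx.
by rewrite nwalks0 eq_sym (negbTE yx).
Qed.

Lemma walk_energy_logconvex j :
  walk_energy j.+1 ^ 2 <= walk_energy j * walk_energy j.+2.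
Proof.
rewrite (@walk_energy_closed j j.+2); last by rewrite addnS addSn addnS.
exact: (sum_nat_CauchySchwarz (fun p => w j p.1 p.2)).
Qed.

Definition walks_from j x := \sum_y w j x y.

Lemma walks_fromS j x : walks_from j.+1 x = \sum_z F x z * walks_from j z.
Proof.
rewrite /walks_from -add1n; under eq_bigr do rewrite nwalksD.
rewrite exchange_big; apply: eq_bigr => z _.
by rewrite big_distrr; apply: eq_bigr => y _; rewrite nwalks1.
Qed.

(** By symmetry one step can be moved from one factor of the inner product to the other;
    Cauchy-Schwarz does the rest. *)
Lemma walks_from_logconvex j :
  (\sum_x walks_from j.+1 x ^ 2) ^ 2 <=
  (\sum_x walks_from j x ^ 2) * (\sum_x walks_from j.+2 x ^ 2).
Proof.
have -> : \sum_x walks_from j.+1 x ^ 2 =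
          \sum_x walks_from j x * walks_from j.+2 x.
  under [RHS]eq_bigr do rewrite walks_fromS big_distrr.
  rewrite exchange_big /=; apply: eq_bigr => x _.
  rewrite -mulnn {1}walks_fromS big_distrl; apply: eq_bigr => z _ /=.
  by rewrite Fsym; nia.
exact: sum_nat_CauchySchwarz.
Qed.

Lemma walks_from0 x : walks_from 0 x = 1.
Proof.
rewrite /walks_from (bigD1 x) //= nwalks0 eqxx big1 // => y yx.
by rewrite nwalks0 eq_sym (negbTE yx).
Qed.

Lemma walks_from1 x : walks_from 1 x = #|[set y | F x y]|.
Proof.
rewrite walks_fromS -sum1dep_card [RHS]big_mkcond; apply: eq_bigr => y _.
by rewrite walks_from0 muln1; case: (F x y).
Qed.

(** The Sidorenko bound for even cycles. Let u_j be the sum of [walks_from j x ^ 2]: then u_1 >= e^2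
    / n, log-convexity gives u_j >= n (u_1 / n)^j, and the energy is at least u_j / n. *)
Lemma walk_energy_lower j : 0 < #|V| ->
  (\sum_x #|[set y | F x y]|) ^ (2 * j) <= #|V| ^ (2 * j) * walk_energy j.
Proof.
move=> n0; set e := \sum_x _.
pose u j := \sum_x walks_from j x ^ 2.
have u0 : u 0 = #|V|.
  by rewrite /u -sum1_card; apply: eq_bigr => x _; rewrite walks_from0.
have e2 : e ^ 2 <= #|V| * u 1.
  have -> : e = \sum_x walks_from 1 x.
    by apply: eq_bigr => x _; rewrite walks_from1.
  exact: sum_nat_sqr_le.
have uj : u j <= #|V| * walk_energy j.
  rewrite walk_energyE big_distrr; apply: leq_sum => x _ /=.
  exact: sum_nat_sqr_le.
have := logconvex_exp_le walks_from_logconvex j; rewrite -/(u 0) -/(u 1) -/(u j) u0.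
move=> Hu; rewrite expnM -(leq_pmul2r n0).
have H1 : (e ^ 2) ^ j <= #|V| ^ j * u 1 ^ j.
  by rewrite -expnMn; case: j {uj Hu} => [//|j]; rewrite leq_exp2r.
apply: leq_trans (leq_mul H1 (leqnn _)) _.
rewrite -mulnA; apply: leq_trans (leq_mul (leqnn _) Hu) _.
by rewrite mulnA -expnD addnn -mul2n -mulnA leq_mul // mulnC.
Qed.

Variables (m s Delta : nat) (x0 : V) (S : V -> seq V -> {set V}).
Local Notation k := (2 * m).
Hypothesis m_gt0 : 0 < m.
Hypothesis s_gt0 : 0 < s.
Hypothesis degF : forall x, #|[set y | F x y]| <= Delta.
Hypothesis card_S : forall x p, size p = m -> path F x p -> #|S x p| <= s.

(** A closed walk is listed without its starting point, which equals its last entry. Index [m] is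
    therefore the vertex reached by step m+1, and it is tested against the set that [S] attaches to
    the first m steps. *)
Definition bad_walk p := nth x0 p m \in S (last x0 p) (take m p).
Hypothesis all_bad : forall p, size p = k -> cycle F p ->
  exists2 i, i <= k.-1 & bad_walk (rot i p).

(** Union bound over the 2m rotations, which all contribute equally by [wsum_rot]. *)
Lemma closed_walks_le_bad :
  walk_energy m <= k * \sum_x wsum k x x (fun p => bad_walk p).
Proof.
rewrite (@walk_energy_closed m m m) //.
have -> : \sum_(p : V * V) w m p.1 p.2 * w m p.1 p.2 = \sum_x w k x x.
  rewrite -(pair_bigA _ (fun x y => w m x y * w m x y)) /=.
  apply: eq_bigr => x _; rewrite mul2n -addnn nwalksD; apply: eq_bigr => y _.
  by rewrite (nwalks_sym m y).
have -> : k * \sum_x wsum k x x (fun p => bad_walk p) =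
  \sum_x wsum k x x (fun p => \sum_(i < k) bad_walk (rot i p)).
  under [RHS]eq_bigr do rewrite wsum_sum.
  rewrite exchange_big -{1}[k]card_ord -sum_nat_const; apply: eq_bigr => i _.
  by rewrite (wsum_rot (fun p => bad_walk p)) // ltnW.
apply: leq_sum => x _; apply: leq_wsum => p sp pp lp.
have cp : cycle F p.
  by move: pp lp; case: (p) => //= a q /andP[xa aq] la; rewrite rcons_path aq la.
have [i ik bi] := all_bad sp cp.
have ik' : i < k by rewrite (leq_ltn_trans ik) // prednK // muln_gt0.
by rewrite (bigD1 (Ordinal ik')) //= bi.
Qed.

Definition nbad x y z := wsum m x y (fun p => z \in S x p).

Lemma bad_walksE : \sum_x wsum k x x (fun p => bad_walk p) =
  \sum_x \sum_y \sum_(z | F y z) nbad x y z * w m.-1 z x.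
Proof.
apply: eq_bigr => x _; rewrite mul2n -addnn wsum_cat; apply: eq_bigr => y _.
rewrite {2}(_ : m = m.-1.+1); last by rewrite prednK.
rewrite /= wsum_sum; apply: eq_bigr => z yz.
rewrite -wsumMr; apply: eq_wsum => p sp pp lp.
rewrite -wsumMl; apply: eq_wsum => q sq pq lq; rewrite muln1.
by rewrite /bad_walk take_size_cat // nth_cat sp ltnn subnn last_cat /= lq.
Qed.

Lemma sum_nbad_le x y : \sum_z nbad x y z <= s * w m x y.
Proof.
rewrite /nbad -wsum_sum -wsumMl; apply: leq_wsum => p sp pp lp.
rewrite muln1; apply: leq_trans (card_S sp pp).
by rewrite -sum1_card [leqRHS]big_mkcond leq_sum // => z _; case: ifP.
Qed.

Lemma nbad_le x y z : nbad x y z <= w m x y.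
Proof. by apply: leq_wsum => p *; apply: leq_b1. Qed.

(* Janzer's argument for rainbow even cycles: AM-GM with weight [k * s], so
   that the [nbad] part of the bound is half of what it has to control. *)
Lemma walk_energy_bad : walk_energy m <= k ^ 2 * s * Delta * walk_energy m.-1.
Proof.
have k0 : 0 < k by rewrite muln_gt0.
set B := \sum_x wsum k x x (fun p => bad_walk p).
have HB : walk_energy m <= k * B := closed_walks_le_bad.
pose l := k * s; have l0 : 0 < l by rewrite muln_gt0 k0.
have H : 2 * (l * B) <= s * walk_energy m + l ^ 2 * (Delta * walk_energy m.-1).
  have -> : 2 * (l * B) = \sum_x \sum_y \sum_(z | F y z)
      2 * (nbad x y z * (l * w m.-1 z x)).
    rewrite /B bad_walksE !big_distrr; apply: eq_bigr => x _ /=.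
    rewrite !big_distrr; apply: eq_bigr => y _ /=; rewrite !big_distrr.
    by apply: eq_bigr => z _ /=; nia.
  have -> : s * walk_energy m + l ^ 2 * (Delta * walk_energy m.-1) =
      \sum_x (\sum_y s * w m x y ^ 2 + l ^ 2 * \sum_z Delta * w m.-1 z x ^ 2).
    rewrite big_split /= !walk_energyE; congr (_ + _).
      by rewrite big_distrr; apply: eq_bigr => x _; rewrite big_distrr.
    rewrite -big_distrr; congr (_ * _).
    rewrite big_distrr; apply: eq_bigr => x _; rewrite big_distrr.
    by apply: eq_bigr => y _; rewrite (nwalks_sym _ x).
  apply: leq_sum => x _.
  apply: (@leq_trans (\sum_y \sum_(z | F y z)
      (nbad x y z ^ 2 + (l * w m.-1 z x) ^ 2))).
    by apply: leq_sum => y _; apply: leq_sum => z _; apply: nat_Cauchy.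
  under eq_bigr do rewrite big_split /=; rewrite big_split leq_add //=.
    (* [nbad ^ 2] is at most [nbad] times the number of walks, and [sum_nbad_le] controls the sum
       over [z]. *)
    apply: leq_sum => y _.
    rewrite -mulnn mulnA.
    apply: leq_trans (leq_mul (sum_nbad_le x y) (leqnn _)).
    rewrite big_mkcond big_distrl; apply: leq_sum => z _ /=.
    by case: ifP => // _; rewrite -mulnn leq_mul // nbad_le.
  rewrite (exchange_big_dep predT) //= big_distrr; apply: leq_sum => z _ /=.
  rewrite sum_nat_const expnMn mulnCA leq_mul // leq_mul //.
  apply: leq_trans (degF z); apply: eq_leq; apply: eq_card => y.
  by rewrite !inE Fsym.
rewrite -(leq_pmul2l l0); move: HB H; rewrite /l; set e := walk_energy m.
move: (walk_energy m.-1) => e' HB H.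
have : 2 * (k * s) * e <= k * (2 * ((k * s) * B)).
  by rewrite [leqRHS](_ : _ = (2 * (k * s)) * (k * B)) ?leq_mul //; nia.
move/leq_trans/(_ (leq_mul (leqnn k) H)).
have -> : k * (s * e + (k * s) ^ 2 * (Delta * e')) =
    k * s * e + k * s * (k ^ 2 * s * Delta * e').
  by move: (k) => K; rewrite -!mulnn; nia.
by rewrite -mulnA mul2n -addnn leq_add2l.
Qed.

(** The ratio bound [walk_energy_bad] descends to length 0 by log-convexity, so the energy is at
    most D^m n with D = [k ^ 2 * s * Delta]. Comparing with the lower bound and replacing n by
    [theta ^ m] leaves m-th powers on both sides. *)
Lemma edges_le_of_all_bad theta : #|V| <= theta ^ m ->
  (\sum_x #|[set y | F x y]|) ^ 2 <=
  k ^ 2 * s * Delta * theta * #|V| ^ 2.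
Proof.
move=> Vt; have n0 : 0 < #|V| by apply/card_gt0P; exists x0.
have := walk_energy_lower m n0; set e := \sum_x _ => lo.
have hi : walk_energy m <= (k ^ 2 * s * Delta) ^ m * #|V|.
  have := walk_energy_bad; rewrite -walk_energy0.
  case: (m) m_gt0 => // j _; exact: (logconvex_last_ratio walk_energy_logconvex).
rewrite -(leq_exp2r _ _ m_gt0) -expnM; apply: leq_trans lo _.
apply: leq_trans (leq_mul (leqnn _) hi) _.
move: (_ * Delta) => D.
by rewrite mulnC [leqRHS]expnMn [(D * _) ^ _]expnMn -expnM !leq_mul.
Qed.
End Walks.

(** * Degrees, sparse subsets and random sampling *)

Definition deg_in (V : finType) (F : rel V) (U : {set V}) x :=
  #|[set y in U | F x y]|.

Lemma deg_inS (V : finType) (F : rel V) (U U' : {set V}) x :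
  U' \subset U -> deg_in F U' x <= deg_in F U x.
Proof.
move=> UU; apply/subset_leq_card/subsetP => y; rewrite !inE.
by case/andP => /(subsetP UU) ->.
Qed.

Lemma card_high_deg (V : finType) (F : rel V) (U : {set V}) d :
  #|[set x in U | d < deg_in F U x]| * d <= \sum_(x in U) deg_in F U x.
Proof.
rewrite -sum_nat_const [leqRHS](bigID (fun x => d < deg_in F U x)) /=.
apply: leq_trans (leq_addr _ _).
rewrite (eq_bigl (fun x => (x \in U) && (d < deg_in F U x))) => [|x].
  by apply: leq_sum => x /andP[_ /ltnW].
by rewrite inE.
Qed.

(** Capping the maximum degree improves the average degree, which allows a lower cap in the next
    round. At level i at most n / (4 * 2^i) vertices are missing and the degree sum is within a
    factor 16^i of the target. *)
Lemma exists_sparse_subset (V : finType) (F : rel V) C theta :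
  0 < C -> 0 < theta ->
  (forall (U : {set V}) d, (forall x, x \in U -> deg_in F U x <= d) ->
    (\sum_(x in U) deg_in F U x) ^ 2 <= C * d * theta * #|V| ^ 2) ->
  exists U : {set V}, 4 * #|~: U| <= #|V| /\
    \sum_(x in U) deg_in F U x <= 1024 * C * theta * #|V|.
Proof.
move=> C0 t0 HF; set n := #|V|.
suff h i : exists U : {set V}, 4 * 2 ^ i * #|~: U| <= n /\
    \sum_(x in U) deg_in F U x <= 1024 * C * 16 ^ i * theta * n.
  by have [U [U1 U2]] := h 0; exists U; rewrite !muln1 in U1 U2.
(* At level [N] the full vertex set qualifies. The induction descends from there; truncated
   subtraction makes steps below level 0 trivial. *)
have [N iN] : exists N, i <= N /\ n <= 16 ^ N.
  exists (maxn i n); split; first exact: leq_maxl.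
  apply: leq_trans (leq_maxr i n) _; apply: ltnW; exact: ltn_expl.
case: iN => iN nN; rewrite -(subKn iN); move: (N - i) => j {i iN}.
elim: j => [|j IH].
  rewrite subn0; exists setT; rewrite setCT cards0 muln0; split => //.
  apply: (@leq_trans (\sum_(x in [set: V]) n)).
    by apply: leq_sum => x _; apply: max_card.
  rewrite sum_nat_const cardsT -/n leq_mul //.
  apply: leq_trans nN _; rewrite -mulnA mulnC -!mulnA leq_pmulr //.
  by rewrite !muln_gt0 t0 C0.
case: (leqP N j) => [Nj|jN].
  by move: IH; rewrite (eqP (Nj : N - j == 0)) (eqP (leqW Nj : N - j.+1 == 0)).
have e : N - j = (N - j.+1).+1 by lia.
rewrite e in IH; move: (N - j.+1) IH => i [U [U1 U2]] {e jN}.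
set D := 1024 * C * 16 ^ i.+1 * theta in U2.
have D0 : 0 < D by rewrite !muln_gt0 C0 expn_gt0.
(* By Markov, removing degrees above [l * D] costs at most n / l vertices, as many as may already be
   missing, so the total loss fits level i. *)
pose l := 4 * 2 ^ i.+1.
pose R := [set x in U | l * D < deg_in F U x].
have Rl : l * #|R| <= n.
  have := leq_trans (card_high_deg F U (l * D)) U2; rewrite -/R.
  by rewrite mulnA [D * n]mulnC leq_pmul2r // mulnC.
exists (U :\: R); split.
  have -> : ~: (U :\: R) = ~: U :|: R.
    by apply/setP => x; rewrite !inE; case: (x \in U); rewrite ?andbF ?andbT ?negbK.
  apply: leq_trans (leq_mul (leqnn _) (leq_card_setU _ R)) _.
  rewrite /l expnS in U1 Rl; move: (2 ^ i) U1 Rl => b; nia.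
have h x : x \in U :\: R -> deg_in F (U :\: R) x <= l * D.
  rewrite !inE => /andP[xR xU]; move: xR; rewrite xU -leqNgt.
  by apply: leq_trans; apply: deg_inS; apply: subsetDl.
have := HF _ _ h; rewrite -/n => h2.
rewrite -(@leq_exp2r _ _ 2) //; apply: leq_trans h2 _.
rewrite /l /D expnS [16 ^ i.+1]expnS.
have -> : 16 ^ i = 2 ^ i * 2 ^ i * 2 ^ i * 2 ^ i.
  by rewrite (_ : 16 = 2 ^ 4) // -expnM mulnC expnM !expnS expn0; lia.
have b0 : 0 < 2 ^ i by rewrite expn_gt0.
move: (2 ^ i) b0 => b b0; rewrite -!mulnn.
pose y := C * theta * n * b * b.
have -> : C * (4 * (2 * b) * (1024 * C * (16 * (b * b * b * b)) * theta)) *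
   theta * (n * n) = 131072 * b * y * y by rewrite /y; ring.
have -> : 1024 * C * (b * b * b * b) * theta * n *
 (1024 * C * (b * b * b * b) * theta * n) = 131072 * b * y * y * (8 * b * b * b).
  by rewrite /y; ring.
by rewrite leq_pmulr // !muln_gt0 b0.
Qed.

(** Deleting a vertex of degree at most [l] lowers the degree sum by at most [2 * l]. If no such
    vertex is left, a path on [l] vertices can be grown greedily. *)
Lemma sum_deg_le_no_path (V : finType) (F : rel V) (l : nat) (X : {set V}) :
  symmetric F ->
  (forall p, size p = l -> uniq p -> sorted F p -> {subset p <= X} -> False) ->
  \sum_(x in X) deg_in F X x <= 2 * l * #|X|.
Proof.
move=> Fs; have [j] := ubnP #|X|; elim: j X => // j IH X Xj noP.
case: (boolP [exists x in X, deg_in F X x <= l]) => [/existsP[x /andP[xX dx]]|].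
  pose Y := X :\ x.
  have YX : Y \subset X := subsetDl _ _.
  have cX : #|X| = #|Y|.+1 by rewrite (cardsD1 x) xX.
  have IHY : \sum_(y in Y) deg_in F Y y <= 2 * l * #|Y|.
    apply: IH; first by rewrite -ltnS -cX.
    by move=> p sp up pp pY; apply: (noP p) => // y /pY; apply: (subsetP YX).
  rewrite (big_setD1 x) //= -/Y.
  have : \sum_(y in Y) deg_in F X y <= \sum_(y in Y) (deg_in F Y y + F y x).
    apply: leq_sum => y yY; rewrite /deg_in (cardsD1 x) inE xX /= addnC leq_add2r.
    by apply/subset_leq_card/subsetP => z; rewrite !inE => /and3P[-> -> ->].
  rewrite big_split /=.
  have : \sum_(y in Y) F y x <= deg_in F X x.
    rewrite /deg_in -sum1dep_card [leqRHS]big_mkcond [leqLHS]big_mkcond.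
    apply: leq_sum => y _; rewrite !inE Fs.
    by case: (y \in X); case: (y != x); case: (F x y).
  rewrite cX; nia.
rewrite negb_exists => /forallP hd.
have {}hd x : x \in X -> l < deg_in F X x.
  by move=> xX; have := hd x; rewrite xX -ltnNge.
have [->|[x xX]] := set_0Vmem X; first by rewrite big_set0.
exfalso.
have h i : i <= l -> exists p, [/\ size p = i, uniq p, sorted F p & {subset p <= X}].
  elim: i => [|i IHi] il; first by exists [::].
  have [[|y p] [sp up pp pX]] := IHi (ltnW il).
    by exists [:: x]; split => //=; [rewrite -sp|move=> z; rewrite inE => /eqP ->].
  have yX : y \in X by apply: pX; rewrite inE eqxx.
  have [z zN zp] : exists2 z, z \in [set z in X | F y z] & z \notin y :: p.
    apply/subsetPn; apply/negP => /subset_leq_card /leq_trans /(_ (card_size _)).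
    by rewrite sp => h; have := leq_trans (hd _ yX) h; lia.
  move: zN; rewrite inE => /andP[zX yz].
  exists [:: z, y & p]; split => //=; first by rewrite -sp.
  - by rewrite zp.
  - by rewrite Fs yz.
  - by move=> a; rewrite inE => /orP[/eqP->//|/pX].
by have [p [sp up pp pX]] := h l (leqnn l); apply: (noP p).
Qed.

Section Sampling.
Variables (V : finType) (q : nat).
Implicit Types (f : {ffun V -> 'I_q.+1}) (A U : {set V}).

(** For uniformly random [f] each vertex is kept independently with probability 1/(q+1);
    expectations are written as sums over all [f]. *)
Definition sample f : {set V} := [set x | f x == ord0].

Lemma card_sample_sup A :
  #|[set f | A \subset sample f]| * q.+1 ^ #|A| = q.+1 ^ #|V|.
Proof.
have -> : #|[set f | A \subset sample f]| = q.+1 ^ #|~: A|.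
  rewrite -[q.+1 in RHS]card_ord -(card_pffun_on (ord0 : 'I_q.+1)).
  apply: eq_card => f; rewrite inE; apply/subsetP/pffun_onP.
    move=> Af; split=> [|i //]; apply/subsetP => x /=; rewrite !inE => fx.
    by apply: contra fx => /Af; rewrite inE.
  move=> [/subsetP sf _] x xA; rewrite inE; apply: contraTT xA => fx.
  by have := sf x fx; rewrite inE.
by rewrite -expnD addnC cardsC.
Qed.

Lemma sum_sample_sup (T : {set {set V}}) j : {in T, forall A, j <= #|A|} ->
  (\sum_f #|[set A in T | A \subset sample f]|) * q.+1 ^ j <=
  #|T| * q.+1 ^ #|V|.
Proof.
move=> Tj.
have -> : \sum_f #|[set A in T | A \subset sample f]| =
    \sum_(A in T) #|[set f | A \subset sample f]|.
  under eq_bigr do rewrite -sum1dep_card big_mkcondr /=.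
  rewrite exchange_big; apply: eq_bigr => A _.
  by rewrite -sum1dep_card [RHS]big_mkcond.
rewrite big_distrl -sum_nat_const; apply: leq_sum => A AT /=.
by rewrite -(card_sample_sup A) leq_mul // leq_pexp2l // Tj.
Qed.

Lemma exists_sample U (P T : {set {set V}}) k : 0 < k ->
  {in P, forall A, 2 <= #|A|} -> {in T, forall A, 3 <= #|A|} ->
  #|P| <= q.+1 * k * #|U| -> 8 * #|T| <= q.+1 ^ 2 * #|U| ->
  exists S : {set V}, [/\ S \subset U, #|U| <= 2 * q.+1 * #|S|,
    #|[set A in P | A \subset S]| <= 4 * k * #|S|
    & 2 * #|[set A in T | A \subset S]| <= #|S|].
Proof.
move=> k0 P2 T3 Pk Tq; set Q := q.+1.
pose p f := #|[set A in P | A \subset sample f]|.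
pose t f := #|[set A in T | A \subset sample f]|.
have Q0 : 0 < Q ^ #|V| by rewrite expn_gt0.
have sS : \sum_f #|U :&: sample f| * Q = #|U| * Q ^ #|V|.
  under eq_bigr do rewrite mulnC -sum1_card big_mkcond.
  rewrite -big_distrr exchange_big /=.
  under eq_bigr => x _ do under eq_bigr => f _ do rewrite inE.
  rewrite (eq_bigr (fun x => (x \in U) * #|[set f | [set x] \subset sample f]|)).
    rewrite -sum_nat_const big_distrr [RHS]big_mkcond; apply: eq_bigr => x _ /=.
    case: (x \in U); rewrite ?muln0 // mul1n.
    by rewrite -(card_sample_sup [set x]) cards1 expn1 mulnC.
  move=> x _; rewrite -sum1dep_card big_distrr [RHS]big_mkcond /=.
  by apply: eq_bigr => f _; rewrite sub1set; case: (x \in U); case: (_ \in _).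
have sP : (\sum_f p f) * Q ^ 2 <= #|P| * Q ^ #|V| := sum_sample_sup P2.
have sT : (\sum_f t f) * Q ^ 3 <= #|T| * Q ^ #|V| := sum_sample_sup T3.
(* One linear inequality encodes all three requirements. Multiplied by the number of functions, the
   averages on the left are at most 2k|U|, k|U| and k|U|, and the right side averages to exactly
   4k|U|. *)
have [f hf] : exists f,
    2 * k * #|U| + Q * p f + 8 * k * Q * t f <= 4 * k * Q * #|U :&: sample f|.
  apply/existsP; rewrite -[X in is_true X]negbK negb_exists.
  apply/negP => /forallP h.
  have : \sum_f 4 * k * Q * #|U :&: sample f| <
      \sum_f (2 * k * #|U| + Q * p f + 8 * k * Q * t f).
    apply: (@leq_trans (\sum_f (4 * k * Q * #|U :&: sample f|).+1)); last first.
      by apply: leq_sum => f _; rewrite ltnNge h.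
    under [leqRHS]eq_bigr do rewrite -addn1; rewrite big_split /=.
    by rewrite sum1_card card_ffun card_ord -addn1 leq_add2l.
  rewrite !big_split /= sum_nat_const card_ffun card_ord -/Q -!big_distrr /=.
  have e1 : 4 * k * Q * (\sum_f #|U :&: sample f|) = 4 * k * (#|U| * Q ^ #|V|).
    by rewrite -sS -big_distrl /=; nia.
  rewrite e1; move: (\sum_f p f) (\sum_f t f) sP sT => sp st sP sT.
  apply/negP; rewrite -leqNgt.
  move: sP sT Pk Tq Q0; rewrite -/Q; move: (Q ^ #|V|) => W sP sT Pk Tq W0.
  have Qp : 0 < Q by [].
  have hP : Q * sp <= k * #|U| * W.
    rewrite -(leq_pmul2r Qp); move: sP; rewrite -mulnn; nia.
  have hT : 8 * Q * st <= #|U| * W.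
    rewrite -(leq_pmul2r (_ : 0 < Q ^ 2)) ?expn_gt0 ?Qp //.
    have : 8 * (st * Q ^ 3) <= 8 * #|T| * W by rewrite -mulnA leq_mul.
    rewrite !expnS expn0 muln1 in Tq *; nia.
  have : k * (8 * Q * st) <= k * (#|U| * W) by rewrite leq_mul.
  nia.
exists (U :&: sample f).
have Qp : 0 < Q by [].
have mon (X : {set {set V}}) : #|[set A in X | A \subset U :&: sample f]| <=
    #|[set A in X | A \subset sample f]|.
  apply/subset_leq_card/subsetP => A; rewrite !inE => /andP[-> AU] /=.
  exact: subset_trans AU (subsetIr _ _).
split; first exact: subsetIl.
- by rewrite -(leq_pmul2l (_ : 0 < 2 * k)) ?muln_gt0 //; nia.
- apply: leq_trans (mon P) _; rewrite -/(p f) -(leq_pmul2l Qp); nia.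
- apply: leq_trans (_ : 2 * t f <= _); first by rewrite leq_mul // mon.
  by rewrite -(leq_pmul2l (_ : 0 < 4 * k * Q)) ?muln_gt0 ?k0 //; nia.
Qed.
End Sampling.

(** * Independent sets in triangle-free graphs *)

(** Complementation in [X] pairs the subsets, so their average size is half of that of [X]. *)
Lemma sum_card_powerset (T : finType) (X : {set T}) :
  2 * \sum_(Y in powerset X) #|Y| = #|X| * 2 ^ #|X|.
Proof.
rewrite mul2n -addnn {2}(reindex_onto (fun Y => X :\: Y) (fun Y => X :\: Y)) /=.
  rewrite [X in _ + X](eq_bigl (mem (powerset X))) => [|Y].
    rewrite -big_split /= -card_powerset mulnC -sum_nat_const.
    apply: eq_bigr => Y; rewrite inE => YX.
    by rewrite -(cardsID Y X) (setIidPr YX).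
  rewrite !inE subsetDl /=; apply/eqP/idP => [<-|YX]; first exact: subsetDl.
  by rewrite setDDr setDv set0U (setIidPr YX).
by move=> Y; rewrite inE => YX; rewrite setDDr setDv set0U (setIidPr YX).
Qed.

Section TriangleFree.
Variables (V : finType) (G : rel V) (X : {set V}) (Delta L : nat).
Hypothesis Gsym : symmetric G.
Hypothesis Girr : irreflexive G.
Hypothesis triangle_free : forall x y z, x \in X -> y \in X -> z \in X ->
  G x y -> G y z -> G x z -> False.
Hypothesis deg_le : forall x, x \in X -> deg_in G X x <= Delta.
Hypothesis L_le : 2 ^ (5 * L) <= Delta.

Definition indep (W : {set V}) := [forall x in W, forall y in W, ~~ G x y].

Lemma indepP (W : {set V}) : reflect {in W &, forall x y, ~~ G x y} (indep W).
Proof.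
apply: (iffP forall_inP) => h x => [y xW yW|xW].
  exact: (forall_inP (h x xW)).
by apply/forall_inP => y; apply: h.
Qed.

Let I := [set W : {set V} | (W \subset X) && indep W].

(** For x >= 4L the term [x * 2 ^ x] suffices; otherwise L(2^x + 1) <= 2^L * 2^(4L) <= Delta. *)
Lemma weight_ineq x : 2 * L * (2 ^ x).+1 <= 2 * Delta + x * 2 ^ x.
Proof.
case: (leqP (4 * L) x) => [Lx|xL].
  have : 0 < 2 ^ x by rewrite expn_gt0.
  have : 4 * L * 2 ^ x <= x * 2 ^ x by rewrite leq_mul.
  nia.
have h1 : 2 ^ x < 2 ^ (4 * L) by rewrite ltn_exp2l.
have h2 : L <= 2 ^ L by apply: ltnW; apply: ltn_expl.
have h3 : L * (2 ^ x).+1 <= Delta.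
  apply: leq_trans L_le; rewrite (_ : 5 * L = L + 4 * L); last by lia.
  by rewrite expnD leq_mul.
by apply: leq_trans (leq_addr _ _); rewrite -mulnA leq_mul.
Qed.

(** The independent sets are grouped by their part [K] outside [v] and its neighbourhood; the bound
    holds within each group. *)
Lemma local_weight v : v \in X ->
  L * #|I| <= \sum_(W in I) (Delta * (v \in W) + #|[set y in X | G v y] :&: W|).
Proof.
move=> vX; set N := [set y in X | G v y].
pose core (W : {set V}) := W :\: (v |: N).
rewrite mulnC -sum_nat_const (partition_big core predT) //=.
rewrite [leqRHS](partition_big core predT) //=.
apply: leq_sum => K _.
case: (set_0Vmem [set W in I | core W == K]) => [e|[W0]].
  by rewrite !big_pred0 // => W; move/setP/(_ W): e; rewrite !inE.
rewrite !inE => /andP[/andP[W0X /indepP W0i] /eqP cW0].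
have KW0 : K \subset W0 by rewrite -cW0 subsetDl.
have vK : v \notin K by rewrite -cW0 !inE eqxx.
have KN x : x \in K -> x \notin N.
  by rewrite -cW0 !inE negb_or => /andP[/andP[_ ->]].
have KX x : x \in K -> x \in X by move/(subsetP KW0)/(subsetP W0X).
have Ki : {in K &, forall x y, ~~ G x y}.
  by move=> x y /(subsetP KW0) xW /(subsetP KW0) yW; apply: W0i.
pose X0 := [set y in N | [forall x in K, ~~ G x y]].
have X0N : X0 \subset N by apply/subsetP => y; rewrite inE => /andP[].
have vN : v \notin N by rewrite inE Girr andbF.
(* Either [v] is added to [K], or any set of neighbours of [v] with no neighbour in [K];
   triangle-freeness makes every such set independent. With x = [#|X0|] the class has 1 + 2^x
   members. *)
pose cls := (v |: K) |: [set K :|: Y | Y in powerset X0].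
have clsE W : (W \in I) && (core W == K) = (W \in cls).
  apply/idP/idP.
    rewrite inE => /andP[/andP[WX /indepP Wi] /eqP cW].
    have WE x : x \in W -> x != v -> x \notin N -> x \in K.
      by move=> xW xv xN; rewrite -cW !inE negb_or xv xW /= andbT; rewrite inE in xN.
    have KW : K \subset W by rewrite -cW subsetDl.
    rewrite inE; case: (boolP (v \in W)) => vW.
      apply/orP; left; rewrite inE eqEsubset subUset sub1set vW KW !andbT.
      apply/subsetP => x xW; rewrite inE in_set1; case: eqVneq => //= xv.
      apply: WE => //; rewrite inE negb_and; apply/orP; right; exact: Wi.
    apply/orP; right; apply/imsetP; exists (W :&: N).
      rewrite inE; apply/subsetP => y; rewrite inE => /andP[yW yN].
      rewrite inE yN; apply/forall_inP => x xK; apply: Wi => //.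
      exact: (subsetP KW).
    apply/setP => x; rewrite !in_setU in_setI.
    case: (boolP (x \in K)) => [/(subsetP KW) ->//|xK] /=.
    case: (boolP (x \in W)) => //= xW; case: (boolP (x \in N)) => // xN.
    by case/negP: xK; apply: WE => //; apply: contraNneq vW => <-.
  rewrite inE => /orP[|/imsetP[Y]]; rewrite inE.
    move/eqP->; apply/andP; split; last first.
      apply/eqP/setP => x; rewrite !in_setD !in_setU !in_set1.
      case: eqVneq => [->|] /=; first by rewrite (negbTE vK).
      by move=> _; case: (boolP (x \in K)) => [/KN ->|]; rewrite ?andbF.
    rewrite inE subUset sub1set vX; apply/andP; split; first exact/subsetP.
    have vKi x : x \in K -> ~~ G v x.
      by move=> xK; have := KN _ xK; rewrite inE (KX _ xK).
    apply/indepP => x y; rewrite !in_setU !in_set1.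
    move=> /orP[/eqP->|xK] /orP[/eqP->|yK]; rewrite ?Girr //; first exact: vKi.
      by rewrite Gsym vKi.
    exact: Ki.
  move=> YX0 ->; have YN := subset_trans YX0 X0N.
  apply/andP; split; last first.
    apply/eqP/setP => x; rewrite !in_setD !in_setU !in_set1 negb_or.
    case: (boolP (x \in K)) => [xK|xK] /=.
      by rewrite (KN _ xK) !andbT; apply: contraNneq vK => <-.
    by case: (boolP (x \in Y)) => [/(subsetP YN) ->|_]; rewrite ?andbF.
  rewrite inE; apply/andP; split.
    apply/subsetP => x; rewrite in_setU => /orP[/KX//|/(subsetP YN)].
    by rewrite inE => /andP[].
  have KY x y : x \in K -> y \in Y -> ~~ G x y.
    move=> xK /(subsetP YX0); rewrite inE => /andP[_ /forall_inP]; exact.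
  apply/indepP => x y; rewrite !in_setU => /orP[xK|xY] /orP[yK|yY].
  - exact: Ki.
  - exact: KY.
  - by rewrite Gsym KY.
  - have := subsetP YN _ xY; have := subsetP YN _ yY; rewrite !inE.
    move=> /andP[yX vy] /andP[xX vx]; apply/negP => xy.
    exact: (triangle_free vX xX yX vx xy vy).
rewrite [leqLHS](eq_bigl _ _ clsE) [leqRHS](eq_bigl _ _ clsE).
have ncls : v |: K \notin [set K :|: Y | Y in powerset X0].
  apply/imsetP => -[Y]; rewrite inE => YX0 /setP /(_ v).
  rewrite !in_setU in_set1 eqxx /= (negbTE vK) /= => /esym vY.
  by case/negP: vN; apply: (subsetP X0N); apply: (subsetP YX0).
have inj : {in powerset X0 &, injective (fun Y => K :|: Y)}.
  move=> Y Y'; rewrite !inE => YX YX' /setP e; apply/setP => x.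
  have := e x; rewrite !in_setU; case: (boolP (x \in K)) => // xK _.
  have xX : x \notin X0 by apply: contra (KN _ xK) => /(subsetP X0N).
  have nX (Z : {set V}) : Z \subset X0 -> (x \in Z) = false.
    by move=> /subsetP h; apply: contraNF xX; apply: h.
  by rewrite !nX.
rewrite !big_setU1 //= !big_imset //=.
rewrite -(leq_pmul2l (isT : 0 < 2)) sum_nat_const card_powerset.
have -> : 2 * (L + 2 ^ #|X0| * L) = 2 * L * (2 ^ #|X0|).+1 by nia.
apply: leq_trans (weight_ineq #|X0|) _.
rewrite -sum_card_powerset mulnDr leq_add //.
  by rewrite in_setU in_set1 eqxx muln1 leq_mul // leq_addr.
rewrite leq_mul // leq_sum // => Y; rewrite inE => YX0.
apply: leq_trans (leq_addl _ _); apply/subset_leq_card/subsetP => y yY.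
by rewrite in_setI in_setU yY orbT andbT (subsetP X0N) // (subsetP YX0).
Qed.

(* The average size of a uniformly random independent set (Alon's proof of the
   Ajtai-Komlos-Szemeredi bound). *)
Lemma large_indep_set : exists W : {set V},
  [/\ W \subset X, {in W &, forall x y, ~~ G x y} & L * #|X| <= 2 * Delta * #|W|].
Proof.
have [/existsP[W /andP[]]|] :=
  boolP [exists W in I, L * #|X| <= 2 * Delta * #|W|].
  by rewrite inE => /andP[WX /indepP Wi] h; exists W.
rewrite negb_exists => /forallP h; exfalso.
have I0 : set0 \in I.
  by rewrite inE sub0set; apply/indepP => x y; rewrite inE.
have : \sum_(W in I) 2 * Delta * #|W| < \sum_(W in I) L * #|X|.
  rewrite (bigD1 set0) //= [ltnRHS](bigD1 set0) //=.
  rewrite -addSn leq_add //.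
    by have := h set0; rewrite I0 -ltnNge.
  apply: leq_sum => W /andP[WI _]; have := h W; rewrite WI -ltnNge; exact: ltnW.
apply/negP; rewrite -leqNgt sum_nat_const.
(* Summed over [v], an independent set [W] contributes at most 2 Delta |W|: Delta for each member,
   and at most Delta neighbours of each member. *)
have : \sum_(v in X) L * #|I| <= \sum_(v in X) \sum_(W in I)
   (Delta * (v \in W) + #|[set y in X | G v y] :&: W|).
  by apply: leq_sum => v; apply: local_weight.
rewrite sum_nat_const mulnCA mulnA mulnC [_ * #|X|]mulnC => /leq_trans; apply.
rewrite exchange_big; apply: leq_sum => W; rewrite inE => /andP[WX _].
rewrite big_split /= -mulnA mul2n -addnn leq_add //.
  rewrite -big_distrr leq_mul //= -sum1_card big_mkcond [leqRHS]big_mkcond.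
  by apply: leq_sum => v _; case: (v \in X); case: (v \in W).
rewrite mulnC -sum_nat_const.
apply: leq_trans (_ : \sum_(w in W) deg_in G X w <= _); last first.
  by apply: leq_sum => w /(subsetP WX); apply: deg_le.
rewrite /deg_in; under eq_bigr do rewrite -sum1_card.
under [leqRHS]eq_bigr do rewrite -sum1dep_card.
rewrite (exchange_big_dep (mem W)) => [|v w _] /=; last by rewrite inE => /andP[].
apply: leq_sum => w wW; rewrite !sum1dep_card; apply/subset_leq_card/subsetP => v.
by rewrite !inE wW andbT => /andP[-> /andP[_]]; rewrite Gsym.
Qed.
End TriangleFree.

(** * Kernels and linear cycles *)

Lemma leq_card_bigcup (T I : finType) (P : pred I) (F : I -> {set T}) :
  #|\bigcup_(i | P i) F i| <= \sum_(i | P i) #|F i|.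
Proof.
apply: (big_ind2 (fun (A : {set T}) b => #|A| <= b)) => [|A a B b Aa Bb|//].
  by rewrite cards0.
exact: leq_trans (leq_card_setU _ _) (leq_add Aa Bb).
Qed.

Lemma ordS_neq k (i : 'I_k) : 1 < k -> ordS i != i.
Proof.
move=> k1; apply/eqP => /(congr1 val) /= h.
have := ltn_ord i; rewrite leq_eqVlt => /orP[/eqP hi|hi].
  by move: h; rewrite hi modnn => h0; lia.
by move: h; rewrite modn_small //; lia.
Qed.

Section LinearCycle.
Variables (V : finType) (k : nat).

(** The intersection clauses of a linear cycle alone, so that they apply to kernels of unequal
    sizes. *)
Definition cyclic_pattern (E : 'I_k -> {set V}) :=
  (forall i, #|E i :&: E (ordS i)| = 1) /\
  (forall i j, i != j -> j != ordS i -> i != ordS j -> E i :&: E j = set0).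

Variables (H : {set {set V}}) (r : nat).
Hypothesis Hr : forall e, e \in H -> #|e| = r.

(* As in the delta-system method, a robust set behaves like an edge: it can
   be completed to an edge avoiding as many other vertices as a linear cycle
   has. *)
Definition robust (A : {set V}) : bool :=
  [forall Z : {set V}, (#|Z| <= k * r) && [disjoint A & Z] ==>
    [exists e in H, (A \subset e) && [disjoint e & Z]]].

Lemma robustP (A : {set V}) : reflect
  (forall Z : {set V}, #|Z| <= k * r -> [disjoint A & Z] ->
    exists e, [/\ e \in H, A \subset e & [disjoint e & Z]]) (robust A).
Proof.
apply: (iffP forallP) => h Z; [move=> Zk AZ | apply/implyP => /andP[Zk AZ]].
  have := h Z; rewrite Zk AZ => /existsP[e /and3P[eH Ae eZ]].
  by exists e; split.
have [e [eH Ae eZ]] := h Z Zk AZ.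
by apply/existsP; exists e; rewrite eH Ae.
Qed.

Definition kernels : {set {set V}} :=
  [set A | minset [pred A : {set V} | (2 <= #|A|) && robust A] A].

Lemma kernel_robust A : A \in kernels -> robust A.
Proof. by rewrite inE => /minsetp /andP[]. Qed.

Lemma kernel_card_ge2 A : A \in kernels -> 2 <= #|A|.
Proof. by rewrite inE => /minsetp /andP[]. Qed.

Lemma robust_card A : robust A -> #|A| <= r.
Proof.
move/robustP => /(_ set0); rewrite cards0 => /(_ isT).
rewrite -setI_eq0 setI0 eqxx => /(_ isT) [e [eH Ae _]].
by rewrite -(Hr eH) subset_leq_card.
Qed.

Lemma kernel_card A : A \in kernels -> #|A| <= r.
Proof. by move/kernel_robust/robust_card. Qed.

Lemma kernel_min (A B : {set V}) :
  A \in kernels -> B \subset A -> 2 <= #|B| -> robust B -> B = A.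
Proof. by rewrite inE => /minsetP[_ h] BA B2 rB; apply: h => //=; rewrite B2. Qed.

Lemma edge_contains_kernel e : 2 <= r -> e \in H ->
  exists2 A, A \in kernels & A \subset e.
Proof.
move=> r2 eH; have Pe : [pred A : {set V} | (2 <= #|A|) && robust A] e.
  rewrite /= (Hr eH) r2; apply/robustP => Z _ eZ; exists e; split => //.
by have [A mA Ae] := minset_exists Pe; exists A; rewrite ?inE.
Qed.

(** If [B] is robust, minimality leaves only [B] itself. Otherwise some [Z] of at most [k * r]
    vertices blocks [B], so every kernel containing [B], being robust, meets [Z]; branching over [z]
    in [Z] enlarges [B]. *)
Lemma kernel_codegree j (B : {set V}) : 2 <= #|B| -> r <= #|B| + j ->
  #|[set A in kernels | B \subset A]| <= (k * r).+1 ^ j.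
Proof.
elim: j B => [|j IH] B B2 Bj.
  rewrite expn0; apply: (@leq_trans #|[set B]|); last by rewrite cards1.
  apply/subset_leq_card/subsetP => A; rewrite !inE => /andP[AM BA].
  rewrite eq_sym eqEcard BA; apply: leq_trans (kernel_card _) _.
    by rewrite inE.
  by rewrite addn0 in Bj.
case: (boolP (robust B)) => [rB|/robustP nrB].
  apply: (@leq_trans #|[set B]|); last by rewrite cards1 expn_gt0.
  apply/subset_leq_card/subsetP => A; rewrite !inE => /andP[AM BA].
  by rewrite (@kernel_min A B) // inE.
have /existsP[Z /and3P[Zk BZ /existsPn hZ]] : [exists Z : {set V},
    [&& #|Z| <= k * r, [disjoint B & Z] &
      ~~ [exists e, [&& e \in H, B \subset e & [disjoint e & Z]]]]].
  rewrite -[X in is_true X]negbK negb_exists; apply/negP => /forallP h.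
  apply: nrB => Z Zk BZ; have := h Z; rewrite Zk BZ negbK.
  by case/existsP => e /and3P[eH Be eZ]; exists e.
apply: (@leq_trans (\sum_(z in Z) #|[set A in kernels | z |: B \subset A]|)).
  apply: leq_trans (leq_card_bigcup _ _); apply/subset_leq_card/subsetP => A.
  rewrite !inE => /andP[AM BA]; apply/bigcupP.
  case: (boolP [disjoint A & Z]) => AZ.
    have /kernel_robust/robustP /(_ Z Zk AZ) [e [eH Ae eZ]] : A \in kernels.
      by rewrite inE.
    by have := hZ e; rewrite eH (subset_trans BA Ae) eZ.
  have /existsP[z /andP[zA zZ]] : [exists z, (z \in A) && (z \in Z)].
    move: AZ; rewrite -setI_eq0 => /set0Pn[z]; rewrite inE => zAZ.
    by apply/existsP; exists z.
  by exists z => //; rewrite !inE AM subUset sub1set zA.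
apply: (@leq_trans (\sum_(z in Z) (k * r).+1 ^ j)).
  apply: leq_sum => z zZ; have zB : z \notin B.
    by apply: contraL zZ => zB; rewrite (disjointFr BZ zB).
  by apply: IH; rewrite cardsU1 zB; lia.
by rewrite sum_nat_const expnS leq_mul // leqW.
Qed.

(** The sets are replaced by edges one at a time, each new edge avoiding the other current sets
    outside its own kernel, so no intersection changes. *)
Lemma extend_kernels (A : 'I_k -> {set V}) :
  1 < k -> (forall i, robust (A i)) -> cyclic_pattern A ->
  exists E : 'I_k -> {set V}, (forall i, E i \in H) /\ cyclic_pattern E.
Proof.
move=> k1 rA [A1 A0].
suff h j : j <= k -> exists E : 'I_k -> {set V},
    [/\ forall i : 'I_k, i < j -> E i \in H,
        forall i : 'I_k, j <= i -> E i = A i, forall i, #|E i| <= r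
      & forall i i', i != i' -> E i :&: E i' = A i :&: A i'].
  have [E [EH _ _ EA]] := h k (leqnn _); exists E; split=> [i|]; first exact: EH.
  split=> [i|i i' ii ij ji]; last by rewrite EA // A0.
  by rewrite EA // eq_sym ordS_neq.
elim: j => [|j IH] jk.
  by exists A; split => // i; apply: robust_card.
have [E [EH EA Er EI]] := IH (ltnW jk).
pose i0 := Ordinal jk.
(* All [k] current sets have at most [r] elements; hence the bound [k * r] in [robust]. *)
pose Z := (\bigcup_i E i) :\: A i0.
have Zk : #|Z| <= k * r.
  apply: leq_trans (subset_leq_card (subsetDl _ _)) _.
  apply: leq_trans (leq_card_bigcup _ _) _.
  apply: (@leq_trans (\sum_(i < k) r)); first exact: leq_sum.
  by rewrite sum_nat_const card_ord.
have AZ : [disjoint A i0 & Z].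
  by rewrite -setI_eq0; apply/eqP/setP => x; rewrite !inE; case: (x \in A i0).
have /robustP /(_ Z Zk AZ) [e [eH Ae eZ]] := rA i0.
have eE i : i != i0 -> e :&: E i = A i0 :&: A i.
  move=> ii0; rewrite -(EI i0 i) 1?eq_sym // (EA i0) //.
  apply/setP => x; rewrite !inE; case xE: (x \in E i); rewrite ?andbF ?andbT //.
  apply/idP/idP => [xe|]; last exact: (subsetP Ae).
  apply: contraTT xe => xA; suff xZ : x \in Z by rewrite (disjointFl eZ xZ).
  by rewrite inE xA; apply/bigcupP; exists i.
exists (fun i => if i == i0 then e else E i); split.
- move=> i; rewrite ltnS leq_eqVlt; case: (eqVneq i i0) => // ne.
  move=> /orP[/eqP h|]; last exact: EH.
  by case/eqP: ne; apply: val_inj.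
- move=> i ji; case: (eqVneq i i0) ji => [->|_ /ltnW /EA//]; by rewrite ltnn.
- by move=> i; case: eqVneq => // _; rewrite (Hr eH).
- move=> i i'; case: (eqVneq i i0) => [->|ni]; case: (eqVneq i' i0) => [->|ni'].
  + by [].
  + by move=> _; apply: eE.
  + by move=> _; rewrite setIC eE // setIC.
  + exact: EI.
Qed.
End LinearCycle.

(** * Copies of linear cycles from cyclic patterns *)

Section Blocks.
Variables (k : nat) (T : finType) (e : 'I_k -> {set T}).
Hypothesis k4 : 4 <= k.
Hypothesis pat : cyclic_pattern e.

(* The edges of a linear cycle, each without its intersection with the
   preceding edge, partition the vertices; [block_seq i] lists the [i]-th block
   starting with the vertex shared with the next edge. *)
Definition block i := e i :\: e (ord_pred i).
Definition block_seq i :=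
  enum (e i :&: e (ordS i)) ++ enum (block i :\: e (ordS i)).

(** For [k] = 3 these two edges would be consecutive; [k4] keeps them apart. *)
Lemma cyclic_pattern_skip i : e (ordS i) :&: e (ord_pred i) = set0.
Proof.
apply: (proj2 pat).
- apply/eqP => /(congr1 (@ordS k)); rewrite ord_predK => /(congr1 val) /=.
  have := ltn_ord i; rewrite leq_eqVlt => /orP[/eqP hi|hi].
    by rewrite hi modnn modn_small; lia.
  rewrite (modn_small hi); move: hi; rewrite leq_eqVlt => /orP[/eqP hi|hi].
    by rewrite hi modnn; lia.
  by rewrite modn_small; lia.
- apply/eqP => /(congr1 (@ordS k)); rewrite ord_predK => /(congr1 val) /=.
  have := ltn_ord i; rewrite leq_eqVlt => /orP[/eqP hi|hi].
    by rewrite hi modnn !modn_small; lia.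
  rewrite (modn_small hi); move: hi; rewrite leq_eqVlt => /orP[/eqP hi|hi].
    by rewrite hi modnn !modn_small; lia.
  rewrite (modn_small hi); move: hi; rewrite leq_eqVlt => /orP[/eqP hi|hi].
    by rewrite hi modnn; lia.
  by rewrite modn_small; lia.
- rewrite ord_predK ordS_neq //; lia.
Qed.

Lemma mem_block_seq i x : (x \in block_seq i) = (x \in block i).
Proof.
rewrite mem_cat !mem_enum !inE.
have /setP/(_ x) := cyclic_pattern_skip i; rewrite !inE.
by case: (x \in e i); case: (x \in e (ordS i)); case: (x \in e (ord_pred i)).
Qed.

Lemma block_seq_uniq i : uniq (block_seq i).
Proof.
rewrite cat_uniq !enum_uniq andbT; apply/hasPn => x.
by rewrite !mem_enum !inE => /andP[/negbTE ->]; rewrite andbF.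
Qed.

Lemma cards_cyclic_pattern_pred i : #|e i :&: e (ord_pred i)| = 1.
Proof. by rewrite setIC -{2}(ord_predK i) (proj1 pat). Qed.

Lemma size_block_seq i : size (block_seq i) = #|e i|.-1.
Proof.
rewrite -(cardsID (e (ord_pred i)) (e i)) cards_cyclic_pattern_pred /=.
rewrite -/(block i) -(card_uniqP (block_seq_uniq i)).
by apply: eq_card => x; rewrite mem_block_seq.
Qed.

Lemma block_inj i j x : x \in block i -> x \in block j -> i = j.
Proof.
rewrite !inE => /andP[xi' xi] /andP[xj' xj]; case: (eqVneq i j) => // ij.
case: (eqVneq j (ordS i)) => [h|ji].
  by move: xj'; rewrite h ordSK xi.
case: (eqVneq i (ordS j)) => [h|ij'].
  by move: xi'; rewrite h ordSK xj.
by have /setP/(_ x) := proj2 pat i j ij ji ij'; rewrite !inE xi xj.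
Qed.

Lemma block_cover i x : x \in e i -> exists j, x \in block j.
Proof.
move=> xi; case: (boolP (x \in e (ord_pred i))) => [xp|xp]; last first.
  by exists i; rewrite inE xp.
exists (ord_pred i); rewrite inE xp andbT; apply/negP => xpp.
have /setP/(_ x) := cyclic_pattern_skip (ord_pred i).
by rewrite !inE ord_predK xi xpp.
Qed.

(** With the shared vertex always at position 0, a map preserving block and position sends shared
    vertices to shared vertices. *)
Lemma shared_block i x : x \in e i -> x \in e (ordS i) ->
  x \in block i /\ index x (block_seq i) = 0.
Proof.
move=> xi xs; split.
  by rewrite -mem_block_seq mem_cat mem_enum inE xi xs.
have /eqP/cards1P[y ey] := proj1 pat i.
have : x \in e i :&: e (ordS i) by rewrite inE xi.
by rewrite /block_seq ey enum_set1 inE => /eqP -> /=; rewrite eqxx.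
Qed.

Lemma head_block_seq x0 i : nth x0 (block_seq i) 0 \in e i :&: e (ordS i).
Proof.
rewrite /block_seq; have /eqP/cards1P[y ->] := proj1 pat i.
by rewrite enum_set1 /= inE.
Qed.
End Blocks.

(** All blocks on both sides have r - 1 vertices, so matching equal positions in equally indexed
    blocks defines an injection. *)
Lemma cyclic_pattern_copy r k (C : uhypergraph r) (V : finType)
    (E : 'I_k -> {set V}) : 4 <= k -> is_linear_cycle k C ->
  (forall i, #|E i| = r) -> cyclic_pattern E ->
  exists2 f : vertex C -> V, injective f &
    forall c, c \in edges C -> exists i, f @: c = E i.
Proof.
move=> k4 [e [eC ecov e1 e0]] Er patE.
have pate : cyclic_pattern e by [].
have er i : #|e i| = r by apply: (@edges_uniform _ C); rewrite eC imset_f.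
have k0 : 0 < k by lia.
have [d _] : exists d, d \in E (Ordinal k0) :&: E (ordS (Ordinal k0)).
  by apply/set0Pn; rewrite -card_gt0 (proj1 patE).
pose bl v := odflt (Ordinal k0) [pick i | v \in block e i].
have blP v : v \in block e (bl v).
  rewrite /bl; case: pickP => //= h.
  by have [i /(block_cover k4 pate) [j]] := ecov v; rewrite h.
have blE v i : v \in block e i -> bl v = i.
  by move=> vi; apply: (block_inj pate (blP v) vi).
pose f v := nth d (block_seq E (bl v)) (index v (block_seq e (bl v))).
have ilt v : index v (block_seq e (bl v)) < size (block_seq E (bl v)).
  have : index v (block_seq e (bl v)) < size (block_seq e (bl v)).
    by rewrite index_mem mem_block_seq.
  by rewrite !size_block_seq // Er er.
have fB v : f v \in block E (bl v).
  by rewrite -mem_block_seq // mem_nth.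
have finj : injective f.
  move=> v v' fv; have bb : bl v = bl v'.
    by apply: (block_inj patE (fB v)); rewrite fv; apply: fB.
  move: fv; rewrite /f bb => /eqP.
  rewrite nth_uniq ?block_seq_uniq //; last by rewrite -bb.
  move=> /eqP; rewrite -bb; move: (bl v) bb (blP v) (blP v') => i <- vi vi' ii.
  rewrite -(nth_index v (_ : v \in block_seq e i)) ?mem_block_seq // ii.
  by rewrite nth_index // mem_block_seq.
exists f => // c; rewrite eC => /imsetP[i _ ->]; exists i.
apply/eqP; rewrite eqEcard card_imset // er Er leqnn andbT.
apply/subsetP => x /imsetP[v vi ->].
(* A vertex of [e i] lies in block [i] or is the head of the preceding block, whose image lies in
   both edges. *)
case: (boolP (v \in e (ord_pred i))) => vp; last first.
  have /blE b : v \in block e i by rewrite inE vp.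
  by have := fB v; rewrite b inE => /andP[].
have vs : v \in e (ordS (ord_pred i)) by rewrite ord_predK.
have [/blE b i0] := shared_block k4 pate vp vs.
have := head_block_seq patE d (ord_pred i); rewrite ord_predK inE.
by rewrite /f b i0 => /andP[].
Qed.

(** * The shadow graph of the kernels *)

Lemma nth_rot (T : Type) (x0 : T) (p : seq T) i j : i <= size p -> j < size p ->
  nth x0 (rot i p) j = nth x0 p ((i + j) %% size p).
Proof.
move=> ip jp; rewrite /rot nth_cat size_drop nth_drop; case: ltnP => h.
  by rewrite modn_small //; lia.
have e : i + j = size p + (j - (size p - i)) by lia.
rewrite e modnDl modn_small ?nth_take //; lia.
Qed.

Lemma last_iota n l : last n (iota n.+1 l) = n + l.
Proof. by elim: l n => [|l IH] n /=; rewrite ?addn0 // IH addSnnS. Qed.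

Lemma ordS_neq2 k (i : 'I_k) : 2 < k -> ordS (ordS i) != i.
Proof.
move=> k2; apply/eqP => /(congr1 val) /= h; have ik := ltn_ord i; move: h.
case: (ltngtP i.+1 k) => [h||h]; [|lia|].
  rewrite (modn_small h); case: (ltngtP i.+2 k) => [h2||h2]; [|lia|].
    by rewrite modn_small //; lia.
  by rewrite h2 modnn; lia.
by rewrite h modnn modn_small; lia.
Qed.

Section Shadow.
Variables (V : finType) (H : {set {set V}}) (r m : nat).
Hypothesis Hr : forall e, e \in H -> #|e| = r.
Hypothesis r2 : 2 <= r.
Hypothesis m2 : 2 <= m.
Local Notation k := (2 * m).
Hypothesis acyclic : forall E : 'I_k -> {set V},
  (forall i, E i \in H) -> cyclic_pattern E -> False.
Local Notation M := (kernels k H r).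
Definition codeg_bound := (k * r).+1 ^ r.
Local Notation c := codeg_bound.

Lemma acyclic_kernels (A : 'I_k -> {set V}) :
  (forall i, A i \in M) -> cyclic_pattern A -> False.
Proof.
move=> AM patA.
have [E [EH patE]] : exists E : 'I_k -> {set V},
    (forall i, E i \in H) /\ cyclic_pattern E.
  apply: (extend_kernels Hr _ _ patA) => [|i]; first by lia.
  exact: kernel_robust.
exact: (acyclic EH patE).
Qed.

Lemma pair_codegree x y : x != y ->
  #|[set A in M | [set x; y] \subset A]| <= c.
Proof.
by move=> xy; apply: kernel_codegree => //; rewrite cards2 xy // leq_addl.
Qed.

Definition shadow x y := (x != y) && [exists A in M, (x \in A) && (y \in A)].
(** A fixed choice of kernel for each shadow edge, in the role of the colour in rainbow cycle
    arguments; the default [set0] occurs only off the shadow. *)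
Definition shadow_kernel x y : {set V} :=
  odflt set0 [pick A in M | (x \in A) && (y \in A)].
Local Notation F := shadow.
Local Notation phi := shadow_kernel.

Lemma shadow_sym : symmetric F.
Proof.
move=> x y; rewrite /F eq_sym; congr (_ && _).
by apply: eq_existsb => A; rewrite [(x \in A) && _]andbC.
Qed.

Lemma shadow_kernelP x y : F x y -> [/\ phi x y \in M, x \in phi x y & y \in phi x y].
Proof.
rewrite /F /phi => /andP[_ /existsP[A hA]]; case: pickP => [B /and3P[]//|h].
by have := h A; rewrite hA.
Qed.

Fixpoint walk_cover x p : {set V} :=
  if p is y :: p' then phi x y :|: walk_cover y p' else set0.

Lemma card_walk_cover x p : path F x p -> #|walk_cover x p| <= size p * r.
Proof.
elim: p x => [|y p IH] x /=; first by rewrite cards0.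
case/andP => xy /IH h; rewrite mulSn.
apply: leq_trans (leq_card_setU _ _) (leq_add _ h).
by have [AM _ _] := shadow_kernelP xy; apply: kernel_card AM.
Qed.

Lemma mem_walk_cover (g : nat -> V) w a j l : a <= j < a + l ->
  w \in phi (g j) (g j.+1) -> w \in walk_cover (g a) [seq g i | i <- iota a.+1 l].
Proof.
elim: l a => [|l IH] a ajl; first by lia.
move=> wj; rewrite /= inE; case: (eqVneq a j) => [->|aj]; first by rewrite wj.
by apply/orP; right; apply: IH => //; lia.
Qed.

(** A step is bad if its kernel meets an earlier kernel of the walk somewhere other than at the
    current endpoint. *)
Definition bad_next x p := [set z | F (last x p) z &&
  [exists w in walk_cover x p, (w != last x p) && (w \in phi (last x p) z)]].

(** A bad [z] lies in a kernel through the endpoint and some covered [w]; each [w] allows at most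
    [c] kernels of at most [r] vertices. *)
Lemma card_bad_next x p : path F x p -> #|bad_next x p| <= size p * r * (c * r).
Proof.
move=> xp; set y := last x p.
apply: leq_trans (_ : \sum_(w in walk_cover x p) (c * r) <= _); last first.
  by rewrite sum_nat_const leq_mul // card_walk_cover.
pose cl w := if w == y then set0 else
  \bigcup_(A in [set A in M | [set y; w] \subset A]) A.
apply: leq_trans (_ : #|\bigcup_(w in walk_cover x p) cl w| <= _).
  apply/subset_leq_card/subsetP => z; rewrite inE => /andP[yz /existsP[w]].
  case/and3P => wp wy wz; apply/bigcupP; exists w => //.
  rewrite /cl (negbTE wy); have [AM yA zA] := shadow_kernelP yz.
  apply/bigcupP; exists (phi y z) => //.
  by rewrite in_set AM subUset !sub1set yA.
apply: leq_trans (leq_card_bigcup _ _) _; apply: leq_sum => w _.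
rewrite /cl; case: eqVneq => [_|wy]; first by rewrite cards0.
apply: leq_trans (leq_card_bigcup _ _) _.
apply: leq_trans (_ : \sum_(A in [set A in M | [set y; w] \subset A]) r <= _).
  by apply: leq_sum => A; rewrite in_set => /andP[AM _]; apply: kernel_card AM.
by rewrite sum_nat_const leq_mul // pair_codegree // eq_sym.
Qed.

(** If no rotation were bad, the kernels along the walk would form a linear cycle. Checking m steps
    back suffices, since any two of the 2m steps are at cyclic distance at most m. *)
Lemma closed_walk_bad x0 p : size p = k -> cycle F p ->
  exists2 i, i <= k.-1 & bad_walk m x0 bad_next (rot i p).
Proof.
move=> sp cp; have k0 : 0 < k by lia.
have [/existsP[i bi]|] := boolP [exists i : 'I_k, bad_walk m x0 bad_next (rot i p)].
  by exists i => //; have := ltn_ord i; lia.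
rewrite negb_exists => /forallP good; exfalso.
pose X j := nth x0 p (j %% k); pose A j := phi (X j) (X j.+1).
have XK j : X (j + k) = X j by rewrite /X modnDr.
have AK j : A (j + k) = A j by rewrite /A -addSn !XK.
have XM j i : X (j %% k + i) = X (j + i) by rewrite /X modnDml.
have nthX i j : i <= k -> j < k -> nth x0 (rot i p) j = X (i + j).
  by move=> ik jk; rewrite nth_rot ?sp.
have FX j : F (X j) (X j.+1).
  have jk : j %% k < k by rewrite ltn_mod.
  have -> : X j = nth x0 (rot (j %% k) p) 0.
    by rewrite nthX ?XM ?addn0 // ltnW.
  have -> : X j.+1 = nth x0 (rot (j %% k) p) 1.
    by rewrite nthX ?XM ?addn1 //; [exact: ltnW|lia].
  have: cycle F (rot (j %% k) p) by rewrite rot_cycle.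
  have: size (rot (j %% k) p) = k by rewrite size_rot.
  case: (rot _ p) => [|a [|b s]] /=; [by lia|by lia|].
  by move=> _ /andP[].
have AP j : [/\ A j \in M, X j \in A j & X j.+1 \in A j] := shadow_kernelP (FX j).
(* Rotating by n+1 produces the closed walk that starts at [X n]; its first m steps use the kernels
   [A n] to [A (n + m - 1)]. *)
have goodX n j w : n <= j < n + m -> w \in A j -> w \in A (n + m) -> w = X (n + m).
  move=> nj wj wn; set i := n.+1 %% k.
  have ik : i < k by rewrite ltn_mod.
  have XE t : X (i + k.-1 + t) = X (n + t).
    by rewrite -addnA XM (_ : n.+1 + (k.-1 + t) = n + t + k) ?XK //; lia.
  have := good (Ordinal ik); rewrite /bad_walk /= nthX; [|exact: ltnW|lia].
  have -> : last x0 (rot i p) = X n.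
    rewrite (last_nth x0) size_rot sp -(prednK k0) /= nthX; [|exact: ltnW|lia].
    by have := XE 0; rewrite !addn0.
  have -> : take m (rot i p) = [seq X t | t <- iota n.+1 m].
    apply: (@eq_from_nth _ x0).
      by rewrite size_map size_iota size_takel // size_rot sp; lia.
    rewrite size_takel ?size_rot ?sp; last by lia.
    move=> t tm; rewrite nth_take // nthX; [|exact: ltnW|lia].
    by rewrite (nth_map 0) ?size_iota // nth_iota // XM.
  have -> : X (i + m) = X (n + m).+1 by rewrite XM addSn.
  have l : last (X n) [seq X t | t <- iota n.+1 m] = X (n + m).
    by rewrite last_map last_iota.
  rewrite inE l FX /= => /existsP h; apply/eqP; apply: contraT => wX.
  by case: h; exists w; rewrite wX wn andbT (mem_walk_cover nj).
(* Shifting by the period [k] lets the window begin at [b + k - m] without truncated subtraction. *)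
have goodA a b w : a < b <= a + m -> w \in A a -> w \in A b -> w = X b.
  move=> ab wa wb; rewrite -XK.
  have e : b + k = (b + k - m) + m by lia.
  rewrite e; apply: (goodX _ (a + k)); rewrite ?AK // -?e ?AK //; lia.
(* A common vertex would be [X b], which also lies in [A b.-1], hence would equal [X b.-1] too; but
   consecutive vertices differ. *)
have disjA a b : a.+1 < b <= a + m -> A a :&: A b = set0.
  move=> ab; apply/setP => w; rewrite !inE; apply/negP => /andP[wa wb].
  have e : b = b.-1.+1 by lia.
  have wX : w = X b by apply: (goodA a) => //; lia.
  have wX' : w = X b.-1.
    apply: (goodA a) => //; first by lia.
    by rewrite wX [in X b]e; have [] := AP b.-1.
  by have := FX b.-1; rewrite -e -wX -wX' /F eqxx.
have AS (i : 'I_k) : A (ordS i) = A i.+1.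
  by have := XM i.+1 0; have := XM i.+1 1; rewrite !addn0 !addn1 /A /= => -> ->.
apply: (@acyclic_kernels (fun i => A i)); first by move=> i; have [] := AP i.
split=> [i|i j].
  rewrite AS; apply/eqP/cards1P; exists (X i.+1); apply/setP => w.
  rewrite !inE; apply/andP/eqP => [[wi wi1]|->].
    by apply: (goodA i) => //; lia.
  by have [_ _ ->] := AP i; have [_ -> _] := AP i.+1.
wlog ij : i j / i < j => [W ne ji ij|ne ji ij'].
  case: (ltngtP i j) => [h|h|h]; first exact: W.
    by rewrite setIC W // eq_sym.
  by case/eqP: ne; apply: val_inj.
have ij2 : i.+1 < j.
  rewrite ltn_neqAle ij andbT; apply: contraNneq ji => h.
  by apply/eqP/val_inj; rewrite /= h modn_small.
(* If [j] is more than m steps after [i], then [i + k] is fewer than m steps after [j]. *)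
case: (leqP j (i + m)) => h; first by apply: disjA; rewrite ij2.
rewrite setIC -(AK i); apply: disjA.
have h1 : i + k != j.+1.
  apply: contraNneq ij' => h1; have ik := ltn_ord i; have jk := ltn_ord j.
  have [i0 jk'] : i = 0 :> nat /\ j.+1 = k by lia.
  by apply/eqP/val_inj; rewrite /= jk' modnn.
by have := ltn_ord j; lia.
Qed.

Definition shadow_const := k ^ 2 * (m * r * (c * r)).

Lemma shadow_const_gt0 : 0 < shadow_const.
Proof.
by rewrite /shadow_const /codeg_bound !(muln_gt0, expn_gt0) /=; lia.
Qed.

(** The induced subgraph is kept on the vertex set [V] with the rest isolated, so the bound is in
    terms of |V|. *)
Lemma shadow_edges (U : {set V}) d theta : #|V| <= theta ^ m ->
  (forall x, x \in U -> deg_in F U x <= d) ->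
  (\sum_(x in U) deg_in F U x) ^ 2 <= shadow_const * d * theta * #|V| ^ 2.
Proof.
move=> Vt degU; case: (pickP (mem V)) => [x0 _|V0]; last first.
  by rewrite big_pred0 // => x; have := V0 x.
pose FU x y := [&& F x y, x \in U & y \in U].
have FUs : symmetric FU.
  by move=> x y; rewrite /FU shadow_sym [(x \in U) && _]andbC.
have FUF : subrel FU F by move=> x y /and3P[].
have dE x : #|[set y | FU x y]| = if x \in U then deg_in F U x else 0.
  case: ifP => xU.
    by apply: eq_card => y; rewrite !inE /FU xU /= andbC.
  by apply: eq_card0 => y; rewrite !inE /FU xU andbF.
have -> : \sum_(x in U) deg_in F U x = \sum_x #|[set y | FU x y]|.
  by rewrite big_mkcond; apply: eq_bigr => x _; rewrite dE.
apply: (@edges_le_of_all_bad _ _ FUs _ _ _ x0 bad_next) => //.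
- by lia.
- by rewrite /codeg_bound !(muln_gt0, expn_gt0) /=; lia.
- by move=> x; rewrite dE; case: ifP => // /degU.
- by move=> x p <- /(sub_path FUF) /card_bad_next.
move=> p sp cp; apply: closed_walk_bad => //.
by case: (p) cp => //= a s; apply: sub_path.
Qed.

(** * Two-element kernels, triangles and kernel counts *)

Definition kernel_graph x y := (x != y) && ([set x; y] \in M).
Local Notation G := kernel_graph.

Lemma kernel_graph_sym : symmetric G.
Proof. by move=> x y; rewrite /G eq_sym setUC. Qed.

Lemma kernel_graph_irr : irreflexive G.
Proof. by move=> x; rewrite /G eqxx. Qed.

Lemma kernel_graph_shadow x y : G x y -> F x y.
Proof.
move=> /andP[xy A]; rewrite /F xy; apply/existsP; exists [set x; y].
by rewrite A !inE !eqxx orbT.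
Qed.

Lemma deg_kernel_graph U x : deg_in G U x <= deg_in F U x.
Proof.
apply/subset_leq_card/subsetP => y; rewrite !inE => /andP[-> /=].
exact: kernel_graph_shadow.
Qed.

Lemma kernel_graph_no_cycle p : size p = k -> uniq p -> cycle G p -> False.
Proof.
move=> sp up cp; have k0 : 0 < k by lia.
have [x0 _] : exists x0, x0 \in p.
  by case: (p) sp => [|a s _]; [move=> /=; lia | exists a; rewrite inE eqxx].
pose X (i : 'I_k) := nth x0 p i.
have Xinj : injective X.
  move=> i j /eqP; rewrite nth_uniq ?sp // => /eqP; exact: val_inj.
have GX i : G (X i) (X (ordS i)).
  have ik := ltn_ord i.
  have : size (rot i p) = k by rewrite size_rot.
  have : cycle G (rot i p) by rewrite rot_cycle.
  have -> : X i = nth x0 (rot i p) 0.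
    by rewrite nth_rot ?sp // ?addn0 ?modn_small // ltnW.
  have -> : X (ordS i) = nth x0 (rot i p) 1.
    by rewrite nth_rot ?sp ?addn1 //; [exact: ltnW|lia].
  case: (rot i p) => [|a [|b s]] /=; [by lia|by lia|].
  by move=> /andP[].
have Sneq (i : 'I_k) : ordS i != i by apply: ordS_neq; lia.
apply: (@acyclic_kernels (fun i => [set X i; X (ordS i)])).
  by move=> i; case/andP: (GX i).
split=> [i|i j ij ji ij'].
  apply/eqP/cards1P; exists (X (ordS i)); apply/setP => x.
  rewrite !inE; apply/idP/idP; last by move=> /eqP ->; rewrite eqxx orbT.
  move=> /andP[/orP[/eqP->|//] /orP[|]].
    by rewrite (inj_eq Xinj) eq_sym (negbTE (Sneq i)).
  rewrite (inj_eq Xinj) => /eqP h.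
  have k2 : 2 < k by lia.
  by have := ordS_neq2 i k2; rewrite -h eqxx.
apply/setP => x; rewrite !inE; apply/negP => /andP[].
move=> /orP[] /eqP -> /orP[]; rewrite (inj_eq Xinj); apply/negP => //.
- by rewrite eq_sym.
- by rewrite (inj_eq (@ordS_inj k)).
Qed.

(** A path on [k.-1] vertices among the neighbours of [x] would close through [x] to a cycle of
    length [k]. *)
Lemma nbr_deg_sum (U : {set V}) x :
  \sum_(y in [set y in U | G x y]) deg_in G [set y in U | G x y] y <=
  2 * k * deg_in G U x.
Proof.
apply: leq_trans (_ : 2 * k.-1 * deg_in G U x <= _); last first.
  by rewrite leq_mul // leq_mul // leq_pred.
apply: sum_deg_le_no_path; first exact: kernel_graph_sym.
move=> p sp up pp pN; apply: (@kernel_graph_no_cycle (x :: p)).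
- by rewrite /= sp prednK //; lia.
- rewrite /= up andbT; apply/negP => /pN; rewrite inE kernel_graph_irr andbF //.
- case: p sp up pp pN => [|a s] /= sp up pp pN; first by lia.
  have xN y : y \in a :: s -> G x y by move=> /pN; rewrite inE => /andP[].
  rewrite xN ?inE ?eqxx //= rcons_path pp /= kernel_graph_sym xN //.
  exact: mem_last.
Qed.

Definition triangles (U : {set V}) := [set B : {set V} |
  [&& #|B| == 3, B \subset U &
    [forall x in B, forall y in B, (x != y) ==> G x y]]].

Lemma card_triangles (U : {set V}) :
  #|triangles U| <= 2 * k * \sum_(x in U) deg_in F U x.
Proof.
pose N x := [set y in U | G x y].
apply: leq_trans (_ : #|\bigcup_(x in U) \bigcup_(y in N x)
   \bigcup_(z in [set z in N x | G y z]) [set [set x; y; z]]| <= _).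
  apply/subset_leq_card/subsetP => B; rewrite inE => /and3P[/eqP B3 BU /forall_inP h].
  have {}h x y : x \in B -> y \in B -> x != y -> G x y.
    by move=> xB yB; apply/implyP; apply: (forall_inP (h x xB)).
  have /card_gt0P[x xB] : 0 < #|B| by rewrite B3.
  have B2 : #|B :\ x| = 2 by have := cardsD1 x B; rewrite xB B3; lia.
  have /card_gt0P[y yB] : 0 < #|B :\ x| by rewrite B2.
  have B1 : #|(B :\ x) :\ y| = 1.
    by have := cardsD1 y (B :\ x); rewrite yB B2; lia.
  have /card_gt0P[z zB] : 0 < #|(B :\ x) :\ y| by rewrite B1.
  move: (yB) (zB); rewrite !inE => /andP[yx yB'] /and3P[zy zx zB'].
  apply/bigcupP; exists x; first exact: (subsetP BU).
  apply/bigcupP; exists y; first by rewrite inE (subsetP BU) // h // eq_sym.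
  apply/bigcupP; exists z.
    by rewrite !inE (subsetP BU) //= !h // eq_sym.
  rewrite inE eq_sym eqEcard !subUset !sub1set xB yB' zB' /= B3.
  by rewrite -setUA cardsU1 !inE negb_or eq_sym yx eq_sym zx cards2 eq_sym zy.
apply: leq_trans (leq_card_bigcup _ _) _; rewrite big_distrr.
apply: leq_sum => x xU /=.
apply: leq_trans (leq_mul (leqnn _) (deg_kernel_graph U x)).
apply: leq_trans (nbr_deg_sum U x).
apply: leq_trans (leq_card_bigcup _ _) _; apply: leq_sum => y yN.
apply: leq_trans (leq_card_bigcup _ _) _.
by under eq_bigr do rewrite cards1; rewrite sum1_card.
Qed.

(** Each kernel contains a shadow edge, and a shadow edge lies in at most [c] kernels. *)
Lemma card_kernels_in (U : {set V}) :
  #|[set A in M | A \subset U]| <= c * \sum_(x in U) deg_in F U x.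
Proof.
apply: leq_trans (_ : #|\bigcup_(x in U) \bigcup_(y in [set y in U | F x y])
   [set A in M | [set x; y] \subset A]| <= _).
  apply/subset_leq_card/subsetP => A; rewrite inE => /andP[AM AU].
  have A2 := kernel_card_ge2 AM.
  have /card_gt0P[x xA] : 0 < #|A| by lia.
  have /card_gt0P[y] : 0 < #|A :\ x| by have := cardsD1 x A; rewrite xA; lia.
  rewrite !inE => /andP[yx yA].
  apply/bigcupP; exists x; first exact: (subsetP AU).
  apply/bigcupP; exists y; last by rewrite inE AM subUset !sub1set xA.
  rewrite inE (subsetP AU) // /F eq_sym yx; apply/existsP; exists A.
  by rewrite AM xA.
apply: leq_trans (leq_card_bigcup _ _) _; rewrite big_distrr.
apply: leq_sum => x xU /=; apply: leq_trans (leq_card_bigcup _ _) _.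
rewrite /deg_in [leqRHS]mulnC -sum_nat_const; apply: leq_sum => y.
by rewrite inE => /andP[_ /andP[xy _]]; apply: pair_codegree.
Qed.

(** The factor [c + 2 * k] counts kernels and triangles per unit of degree sum,
    [1024 * shadow_const] comes from [exists_sparse_subset], and 2 from |V| <= 2|U|. *)
Definition sample_const := (c + 2 * k) * (1024 * shadow_const) * 2.

Lemma sample_const_gt0 : 0 < sample_const.
Proof.
move: shadow_const_gt0; rewrite /sample_const; move: shadow_const => w w0.
by rewrite !muln_gt0 w0 addn_gt0; lia.
Qed.

(** Here [z] stands for n^(1/(2m)): the sparse subset is taken with [theta] = z^2 and then sampled
    with density of order 1/z. *)
Lemma exists_uniform_sample z : 0 < z -> #|V| <= z ^ k ->
  exists S : {set V}, [/\ #|V| <= 32 * sample_const * z * #|S|,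
    #|[set A in M | (#|A| == 2) && (A \subset S)]| <= 4 * z * #|S| &
    2 * #|[set A in M | (2 < #|A|) && (A \subset S)] :|: triangles S| <= #|S|].
Proof.
move=> z0 Vz; set a := sample_const.
have Vz' : #|V| <= (z ^ 2) ^ m by rewrite -expnM.
have z20 : 0 < z ^ 2 by rewrite expn_gt0 z0.
have [U [U1 U2]] := exists_sparse_subset shadow_const_gt0 z20
  (fun U d => shadow_edges Vz').
have UV : #|V| <= 2 * #|U| by have := cardsC U; lia.
set e := \sum_(x in U) _ in U2.
have eU : (c + 2 * k) * e <= a * z ^ 2 * #|U|.
  apply: leq_trans (leq_mul (leqnn _) U2) _.
  apply: leq_trans (leq_mul (leqnn _) (leq_mul (leqnn _) UV)) _.
  by apply: eq_leq; rewrite /a /sample_const; ring.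
have a0 : 0 < a := sample_const_gt0.
clearbody a.
pose P := [set A in M | (#|A| == 2) && (A \subset U)].
pose T := [set A in M | (2 < #|A|) && (A \subset U)] :|: triangles U.
have sK (Q : pred {set V}) : #|[set A in M | Q A && (A \subset U)]| <= c * e.
  apply: leq_trans (card_kernels_in U); apply/subset_leq_card/subsetP => A.
  by rewrite !inE => /and3P[-> _ ->].
have Pe : #|P| <= a * z ^ 2 * #|U|.
  apply: leq_trans (sK (fun A => #|A| == 2)) _; apply: leq_trans eU.
  by rewrite leq_mul // leq_addr.
have Te : #|T| <= a * z ^ 2 * #|U|.
  apply: leq_trans eU; apply: leq_trans (leq_card_setU _ _) _.
  by rewrite mulnDl leq_add ?card_triangles ?(sK (fun A => 2 < #|A|)).
(* The inverse density Q = [8 * a * z] gives a z^2 <= Q z for pairs and 8 a z^2 <= Q^2 for triangles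
   and larger kernels. *)
have Q0 : 0 < 8 * a * z by rewrite !muln_gt0 a0 z0.
have [||||S [SU S1 S2 S3]] := @exists_sample V (8 * a * z).-1 U P T z z0.
- by move=> A; rewrite inE => /and3P[_ /eqP ->].
- by move=> A; rewrite !inE => /orP[/and3P[_ -> _]//|/and3P[/eqP -> _]].
- rewrite prednK //; apply: leq_trans Pe _; rewrite leq_mul //.
  by rewrite -mulnn -!mulnA leq_pmull.
- rewrite prednK //; apply: leq_trans (leq_mul (leqnn 8) Te) _.
  have -> : (8 * a * z) ^ 2 * #|U| = 8 * (a * z ^ 2 * #|U|) * (8 * a) by ring.
  by rewrite leq_pmulr // muln_gt0 a0.
rewrite prednK // in S1.
exists S; split.
- apply: leq_trans UV _; apply: leq_trans (leq_mul (leqnn 2) S1) _.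
  by apply: eq_leq; ring.
- apply: leq_trans S2; apply/subset_leq_card/subsetP => A; rewrite !inE.
  by move=> /and3P[-> -> AS]; rewrite AS (subset_trans AS SU).
- apply: leq_trans S3; rewrite leq_mul //.
  apply/subset_leq_card/subsetP => A; rewrite !inE.
  case/orP => [/and3P[-> -> AS]|/and3P[-> AS ->]].
    by rewrite AS (subset_trans AS SU).
  by rewrite AS (subset_trans AS SU) orbT.
Qed.

Lemma deg_sum_kernel_graph (S : {set V}) : \sum_(x in S) deg_in G S x <=
  2 * #|[set A in M | (#|A| == 2) && (A \subset S)]|.
Proof.
set P := [set A in M | _].
rewrite [leqRHS]mulnC -sum_nat_const.
apply: leq_trans (_ : \sum_(A in P) \sum_(x in A) 1 <= _); last first.
  by apply: leq_sum => A; rewrite inE sum1_card => /and3P[_ /eqP ->].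
rewrite (exchange_big_dep (mem S)) /=; last first.
  by move=> A x; rewrite inE => /and3P[_ _ /subsetP AS] /AS.
apply: leq_sum => x xS; rewrite sum1dep_card /deg_in.
rewrite -(@card_in_imset _ _ (fun y => [set x; y])).
  apply/subset_leq_card/subsetP => A /imsetP[y]; rewrite inE => /andP[yS].
  move=> /andP[xy xyM] ->; rewrite in_set; apply/andP; split.
    by rewrite in_set xyM cards2 xy subUset !sub1set xS yS.
  by rewrite !inE eqxx.
move=> y y'; rewrite !inE => /andP[_ /andP[xy _]] _ /setP/(_ y).
by rewrite !inE eqxx orbT eq_sym (negbTE xy) => /esym/eqP.
Qed.

(** One chosen vertex is deleted from each member of [T], at most half of [S] in total. *)
Lemma exists_hitting (S : {set V}) (T : {set {set V}}) :
  set0 \notin T -> 2 * #|T| <= #|S| ->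
  exists S' : {set V}, [/\ S' \subset S, #|S| <= 2 * #|S'| &
    forall A, A \in T -> ~~ (A \subset S')].
Proof.
move=> T0 TS; case: (set_0Vmem S) => [->|[x0 _]].
  exists set0; split; rewrite ?cards0 // => A AT; rewrite subset0.
  by apply: contraNneq T0 => <-.
pose pt (A : {set V}) := odflt x0 [pick x in A].
have ptP A : A \in T -> pt A \in A.
  move=> AT; rewrite /pt; case: pickP => //= h; case/negP: T0.
  suff <- : A = set0 by [].
  by apply/setP => x; rewrite inE; apply: h.
exists (S :\: [set pt A | A in T]); split; first exact: subsetDl.
  have := cardsID [set pt A | A in T] S.
  have : #|S :&: [set pt A | A in T]| <= #|T|.
    exact: leq_trans (subset_leq_card (subsetIr _ _)) (leq_imset_card _ _).
  lia.
move=> A AT; apply/subsetPn; exists (pt A); first exact: ptP.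
by rewrite inE imset_f.
Qed.

Lemma large_edgefree_set z L : 0 < z -> #|V| <= z ^ k -> 2 ^ (5 * L) <= 32 * z ->
  exists W : {set V}, (forall e, e \in H -> ~~ (e \subset W)) /\
    L * #|V| <= 8192 * sample_const * z ^ 2 * #|W|.
Proof.
move=> z0 Vz Lz; have [S [S1 S2 S3]] := exists_uniform_sample z0 Vz.
set T := _ :|: _ in S3.
have T0 : set0 \notin T by rewrite !inE cards0 andbF.
have [S' [S'S SS' S'T]] := exists_hitting T0 S3.
(* The degree sum on [S'] is at most 16 z |S'|, so at most half of its vertices have degree above
   [32 * z]. *)
pose Bd := [set x in S' | 32 * z < deg_in G S' x].
pose X := S' :\: Bd.
have XS' : X \subset S' := subsetDl _ _.
have XS := subset_trans XS' S'S.
have S'X : #|S'| <= 2 * #|X|.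
  have h : #|Bd| * (32 * z) <= 16 * z * #|S'|.
    apply: leq_trans (card_high_deg G S' (32 * z)) _.
    apply: leq_trans (deg_sum_kernel_graph S') _.
    apply: leq_trans (_ : 2 * (4 * z * #|S|) <= _); last by nia.
    rewrite leq_mul //; apply: leq_trans S2.
    apply/subset_leq_card/subsetP => A; rewrite !inE => /and3P[-> -> AS'].
    exact: subset_trans AS' S'S.
  have {}h : 2 * #|Bd| <= #|S'|.
    rewrite -(leq_pmul2l (_ : 0 < 16 * z)) ?muln_gt0 //; nia.
  have := cardsID Bd S'; have := subset_leq_card (subsetIr S' Bd).
  rewrite -/X; lia.
have tf x y w : x \in X -> y \in X -> w \in X -> G x y -> G y w -> G x w -> False.
  move=> xX yX wX xy yw xw.
  have sX : [set x; y; w] \subset X by rewrite !subUset !sub1set xX yX.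
  suff hT : [set x; y; w] \in T by have := S'T _ hT; rewrite (subset_trans sX XS').
  have [nxy nyw nxw] : [/\ x != y, y != w & x != w].
    by case/andP: xy => ->; case/andP: yw => ->; case/andP: xw => ->.
  rewrite in_setU; apply/orP; right; rewrite in_set; apply/and3P; split.
  - by rewrite -setUA cardsU1 !inE negb_or nxy nxw cards2 nyw.
  - exact: subset_trans sX XS.
  apply/forall_inP => a aB; apply/forall_inP => b bB; apply/implyP.
  move: aB bB; rewrite !inE => /orP[/orP[]|] /eqP -> /orP[/orP[]|] /eqP -> //;
    by rewrite ?eqxx // kernel_graph_sym.
have dX x : x \in X -> deg_in G X x <= 32 * z.
  rewrite !inE => /andP[xB xS']; move: xB; rewrite xS' -leqNgt.
  by apply: leq_trans; apply: deg_inS.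
have [W [WX Wi WL]] := large_indep_set kernel_graph_sym kernel_graph_irr tf dX Lz.
exists W; split.
  (* A red edge inside [W] would contain a kernel: one of size at least 3 has been destroyed, and
     one of size 2 is an edge of the graph in which [W] is independent. *)
  move=> e eH; apply/negP => eW; have [A AM Ae] := edge_contains_kernel k Hr r2 eH.
  have AW := subset_trans Ae eW; have AX := subset_trans AW WX.
  have := kernel_card_ge2 AM; rewrite leq_eqVlt => /orP[/eqP A2|A2]; last first.
    suff hT : A \in T by have := S'T _ hT; rewrite (subset_trans AX XS').
    by rewrite in_setU; apply/orP; left; rewrite in_set AM A2 (subset_trans AX XS).
  have /cards2P[x [y [xy eA]]] : #|A| == 2 by rewrite -A2.
  have xW : x \in W by apply: (subsetP AW); rewrite eA !inE eqxx.
  have yW : y \in W by apply: (subsetP AW); rewrite eA !inE eqxx orbT.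
  by have := Wi x y xW yW; rewrite /G xy -eA AM.
apply: leq_trans (_ : L * (32 * sample_const * z * (2 * (2 * #|X|))) <= _).
  rewrite leq_mul //; apply: leq_trans S1 _; rewrite leq_mul //.
  by apply: leq_trans SS' _; rewrite leq_mul.
have -> : L * (32 * sample_const * z * (2 * (2 * #|X|))) =
  128 * sample_const * z * (L * #|X|) by ring.
apply: leq_trans (leq_mul (leqnn _) WL) _.
by apply: eq_leq; ring.
Qed.
End Shadow.

(** With n = z^(2m), the edge-free set has order at least L n / z^2 up to a constant, and a set
    without red edges is a blue clique. *)
Lemma blue_clique_of_no_red_cycle m r (C : uhypergraph r) t z L
    (c : {set 'I_(z ^ (2 * m))} -> bool) :
  2 <= m -> 2 <= r -> is_linear_cycle (2 * m) C -> 0 < z ->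
  2 ^ (5 * L) <= 32 * z ->
  8192 * sample_const r m * t <= L * z ^ (2 * m - 2) ->
  ~ contains_copy [set e in complete_edges r (z ^ (2 * m)) | c e] C ->
  contains_copy [set e in complete_edges r (z ^ (2 * m)) | ~~ c e]
    (complete_uhypergraph r t).
Proof.
move=> m2 r2 Cm z0 Lz Kt nC; set n := z ^ (2 * m).
set H := [set e in complete_edges r n | c e] in nC.
have Hr e : e \in H -> #|e| = r.
  by rewrite inE => /andP[/complete_edges_uniform].
have acyc (E : 'I_(2 * m) -> {set 'I_n}) :
    (forall i, E i \in H) -> cyclic_pattern E -> False.
  move=> EH patE; apply: nC; have k4 : 4 <= 2 * m by lia.
  have [f fi fE] := cyclic_pattern_copy k4 Cm (fun i => Hr _ (EH i)) patE.
  by exists f => // e /fE[i ->].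
have nz : #|'I_n| <= z ^ (2 * m) by rewrite card_ord.
have [W [WH WL]] := large_edgefree_set Hr r2 m2 acyc z0 nz Lz.
have tW : t <= #|W|.
  have K0 : 0 < 8192 * sample_const r m * z ^ 2.
    by rewrite muln_gt0 expn_gt0 z0 muln_gt0 (sample_const_gt0 r2 m2).
  rewrite -(leq_pmul2l K0); apply: leq_trans WL; rewrite card_ord /n.
  have -> : z ^ (2 * m) = z ^ (2 * m - 2) * z ^ 2 by rewrite -expnD subnK //; lia.
  rewrite mulnA; apply: leq_trans (leq_mul Kt (leqnn _)).
  by apply: eq_leq; ring.
pose f (i : 'I_t) := enum_val (widen_ord tW i).
have finj : injective f by move=> i j /enum_val_inj /(congr1 val) /= /val_inj.
exists f => //= e; rewrite inE => /eqP er.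
have feW : f @: e \subset W.
  by apply/subsetP => x /imsetP[i _ ->]; apply: enum_valP.
have fer : f @: e \in complete_edges r n by rewrite inE card_imset // er.
rewrite inE fer /=; apply: contraL feW => ce; apply: WH.
by rewrite inE fer.
Qed.

(** * Real estimates *)

From mathcomp Require Import all_order all_algebra.
From mathcomp Require Import all_classical all_reals all_analysis lra.

Import Order.TTheory GRing.Theory Num.Theory.
Local Open Scope ring_scope.

Section RealBound.
Variable R : realType.

Lemma ln_le_pred (x : R) : 0 < x -> ln x <= x - 1.
Proof.
move=> x0; have h : -1 < x - 1 by lra.
by have := le_ln1Dx h; rewrite (_ : 1 + (x - 1) = x) //; ring.
Qed.

Lemma ln_le_sqrt (x : R) : 0 < x -> ln x <= 2 * Num.sqrt x.
Proof.
move=> x0; have s0 : 0 < Num.sqrt x by rewrite sqrtr_gt0.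
have -> : ln x = 2 * ln (Num.sqrt x).
  by rewrite -{1}(sqr_sqrtr (ltW x0)) lnXn // mulr_natl.
by have := ln_le_pred s0; lra.
Qed.

Lemma exists_exponent (z : nat) : (0 < z)%N ->
  exists L : nat, (2 ^ (5 * L) <= 32 * z)%N /\ ln (z%:R : R) <= 5 * L%:R.
Proof.
move=> z0; set l := trunc_log 2 (32 * z).
have /andP[l1 l2] : (2 ^ l <= 32 * z < 2 ^ l.+1)%N.
  by apply: trunc_log_bounds => //; rewrite muln_gt0.
exists (l %/ 5)%N; split.
  by apply: leq_trans l1; rewrite leq_exp2l // mulnC leq_trunc_div.
have zL : (z <= 2 ^ (5 * (l %/ 5)))%N.
  have : (32 * z < 32 * 2 ^ (5 * (l %/ 5)))%N.
    (* Rounding [l] down to a multiple of 5 loses at most 4 in the exponent; with the strict upper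
       bound this is absorbed by 32 = 2^5. *)
    apply: leq_trans l2 _; rewrite -(expnD 2 5) leq_exp2l //.
    by have := ltn_pmod l (isT : (0 < 5)%N); have := divn_eq l 5; lia.
  by rewrite ltn_pmul2l // => /ltnW.
have z0' : 0 < z%:R :> R by rewrite ltr0n.
have : ln (z%:R : R) <= ln ((2 ^ (5 * (l %/ 5)))%:R : R).
  by rewrite ler_ln ?posrE ?ltr0n ?expn_gt0 // ler_nat.
rewrite natrX lnXn //; move/le_trans; apply.
have h : ln (2 : R) <= 1 by have := @ln_le_pred 2 (ltr0n R 2); lra.
by rewrite -[leLHS]mulr_natr natrM -[leRHS]mul1r ler_wpM2r.
Qed.

(** The side [z] is about Y^(1/(2m-2)) with Y a multiple of t / ln t, so z^(2m) has order
    Y^(m/(m-1)). Rounding costs at most z <= 2y, hence the factor 4^m. *)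
Lemma exists_side (m K : nat) : (2 <= m)%N -> (0 < K)%N ->
  exists2 a : R, 0 < a & forall t : nat, (2 <= t)%N -> exists z L : nat,
    [/\ (0 < z)%N, (2 ^ (5 * L) <= 32 * z)%N, (K * t <= L * z ^ (2 * m - 2))%N &
      (z ^ (2 * m))%:R <= a * (t%:R / ln t%:R) `^ (m%:R / (m%:R - 1))].
Proof.
move=> m2 K0; pose d := (2 * m - 2)%N.
have d_neq0 : d != 0%N by rewrite /d; lia.
have m2' : (2 <= 2 * m)%N by lia.
(* The factor 20m pays for ln t <= 20 m L: ln t <= 2 ln Y = 2(2m-2) ln y, and ln y <= ln z <= 5L. *)
pose K' : R := (20 * m * K)%:R.
have K'2 : 2 <= K' by rewrite ler_nat; nia.
have K'0 : 0 < K' by lra.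
have c0 : 0 < (20 * m)%:R :> R by rewrite ltr0n muln_gt0 /=; lia.
have m1 : 1 < m%:R :> R by rewrite ltr1n.
exists (4 ^+ m * K' `^ (m%:R / (m%:R - 1))).
  by rewrite mulr_gt0 ?exprn_gt0 // powR_gt0.
move=> t t2; have t2' : 2 <= t%:R :> R by rewrite ler_nat.
set T : R := t%:R; have T0 : 0 < T by rewrite /T; lra.
have lnT0 : 0 < ln T by apply: ln_gt0; rewrite /T; lra.
pose Y := K' * (T / ln T).
(* Since ln T <= 2 sqrt T, dividing by the logarithm keeps [Y] above sqrt T, so ln Y is at least
   half of ln T. *)
have YT : Num.sqrt T <= Y.
  rewrite /Y mulrA ler_pdivlMr //.
  have := ln_le_sqrt T0; have := sqr_sqrtr (ltW T0); have := sqrtr_ge0 T.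
  by move: (Num.sqrt T) => s s0 sT lnT; nra.
have sT1 : 1 <= Num.sqrt T.
  by rewrite -sqrtr1 ler_wsqrtr // /T; lra.
have Y1 : 1 <= Y by apply: le_trans YT.
have Y0 : 0 < Y by lra.
have dE : d%:R = 2 * (m%:R - 1) :> R.
  by rewrite natrB ?natrM ?mulrBr ?mulr1.
have d0 : 0 < d%:R :> R by rewrite dE; lra.
pose y := Y `^ (d%:R^-1).
have y0 : 0 < y by apply: powR_gt0.
have yd : y ^+ d = Y.
  by rewrite -powR_mulrn ?ltW // -powRrM mulVf ?gt_eqF // powRr1 // ltW.
have y1 : 1 <= y.
  rewrite leNgt; apply/negP => h.
  have : y ^+ d < 1 by rewrite exprn_ilt1 // ltW.
  by rewrite yd; lra.
have /andP[z1 z2] := truncn_itv (ltW y0).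
pose z := (Num.Def.trunc y).+1; rewrite -/z in z2.
have zy : z%:R <= 2 * y by rewrite /z -addn1 natrD; lra.
have z0 : 0 < z%:R :> R by rewrite ltr0n.
have [L [L1 L2]] := @exists_exponent z isT.
exists z, L; split => //.
- rewrite -(ler_nat R) natrM natrM natrX -/T -/d.
  have zd : Y <= z%:R ^+ d.
    by rewrite -yd lerXn2r ?nnegrE ?ltW.
  have lnz : ln T <= (20 * m)%:R * L%:R.
    have h1 : ln y <= ln z%:R by rewrite ler_ln ?posrE // ltW.
    have h2 : ln Y = d%:R * ln y.
      by rewrite /y ln_powR mulrA mulfV ?mul1r // gt_eqF.
    have h3 : ln (Num.sqrt T) <= ln Y.
      by rewrite ler_ln ?posrE // sqrtr_gt0.
    have h4 : ln T = 2 * ln (Num.sqrt T).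
      by rewrite -{1}(sqr_sqrtr (ltW T0)) lnXn ?sqrtr_gt0 // mulr_natl.
    have h5 : d%:R * ln y <= d%:R * (5 * L%:R).
      by rewrite ler_pM2l //; lra.
    have L0 : 0 <= L%:R :> R by [].
    rewrite natrM; rewrite dE in h2 h5; nra.
  have -> : K%:R * T = (ln T / (20 * m)%:R) * Y.
    rewrite /Y /K' (natrM _ _ K); move: (20 * m)%:R c0 => b b0; field.
    by rewrite !gt_eqF.
  apply: ler_pM => //; last first.
  + by rewrite ler_pdivrMr // mulrC.
  + exact: ltW.
  + by rewrite divr_ge0 // ltW.
- rewrite natrX; apply: le_trans (_ : (2 * y) ^+ (2 * m) <= _).
    by rewrite lerXn2r ?nnegrE ?mulr_ge0 // ltW.
  rewrite exprMn (exprM 2) -mulrA (_ : 2 ^+ 2 = 4 :> R); last by ring.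
  have TlnT : 0 <= T / ln T by rewrite divr_ge0 ?ltW.
  rewrite ler_pM2l ?exprn_gt0 // -(powRM _ (ltW K'0) TlnT) -/Y.
  rewrite -(powR_mulrn (2 * m) (ltW y0)) -powRrM dE natrM.
  suff -> : (2 * (m%:R - 1))^-1 * (2 * m%:R) = m%:R / (m%:R - 1) :> R by [].
  have m10 : m%:R - 1 != 0 :> R by rewrite gt_eqF // subr_gt0.
  by field.
Qed.
End RealBound.

(** * Passage to the Ramsey number *)

Lemma ramsey_number_le r (G H : uhypergraph r) n :
  (0 < n)%N -> ramsey_arrow G H n ->
  exists2 n', is_ramsey_number G H n' & (n' <= n)%N.
Proof.
move=> n0 arr; pose P n := (0 < n)%N && `[< ramsey_arrow G H n >].
have exP : exists n, P n by exists n; rewrite /P n0; apply/asboolP.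
case: (ex_minnP exP) => n' /andP[n'0 /asboolP arr'] min'.
exists n'; last by apply: min'; rewrite /P n0; apply/asboolP.
by split => // j j0 arrj; apply: min'; rewrite /P j0; apply/asboolP.
Qed.

Theorem theorem7p10 (R : realType) (m r : nat) (hm : (2 <= m)%N)
    (hr : (3 <= r)%N) :
  exists2 a : R, 0 < a &
    forall t : nat, (2 <= t)%N ->
    forall C : uhypergraph r, is_linear_cycle (2 * m)%N C ->
    exists2 n : nat, is_ramsey_number C (complete_uhypergraph r t) n &
      n%:R <= a * (t%:R / ln t%:R) `^ (m%:R / (m%:R - 1)).
Proof.
have r2 : (2 <= r)%N by exact: ltnW.
have K0 : (0 < 8192 * sample_const r m)%N.
  by rewrite muln_gt0 (sample_const_gt0 r2 hm).
(* The constant is fixed before [t] and the cycle, from [m] and [sample_const r m] alone. *)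
have [a a0 h] := @exists_side R m _ hm K0.
exists a => // t t2 C Cm; have [z [L [z0 Lz Kt zle]]] := h t t2.
have n0 : (0 < z ^ (2 * m))%N by rewrite expn_gt0 z0.
have arr : ramsey_arrow C (complete_uhypergraph r t) (z ^ (2 * m)).
  move=> c; apply/or_asboolP; rewrite -implyNb; apply/implyP => /asboolPn nC.
  by apply/asboolP; exact: (blue_clique_of_no_red_cycle hm r2 Cm z0 Lz Kt nC).
have [n nR nz] := ramsey_number_le n0 arr; exists n => //.
by apply: le_trans zle; rewrite ler_nat.
Qed.
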